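(* Let $\mathcal{B}$ be a finite base class and $\mathcal{H}$ a hypothesis class of functions $\mathcal{X}\to\{\pm1\}$, let $\mathcal{D}\in\Delta(\mathcal{X}\times\{\pm1\})$, and let $\gamma\in(0,1]$. Choose any $\varepsilon,\delta>0$. There exists a choice of the parameters $\eta,\sigma,T,\tau,S_0,S,m$ of the Boosting Algorithm (described in the context) satisfying $$T=\mathcal{O}\!\left(\frac{\log|\mathcal{B}|}{\gamma^2\varepsilon^2}\right),\quad \eta=\mathcal{O}\!\left(\frac{\gamma^2\varepsilon}{\log|\mathcal{B}|}\right),\quad \sigma=\frac{\eta}{\gamma},\quad \tau=\mathcal{O}(\gamma\varepsilon),\quad S=\mathcal{O}\!\left(\frac{1}{\gamma\varepsilon}\right),\quad S_0=\mathcal{O}\!\left(\frac1{\varepsilon^2}\right),\quad m=m(\varepsilon_0,\delta_0)+\mathcal{O}\!\left(\frac{1}{\gamma^2\varepsilon^2}\right)$$ such that for any $\gamma$-agnostic weak learning oracle with respect to $\mathcal{H}$ and $\mathcal{B}$, with sample complexity $m(\cdot,\cdot)$, fixed tolerance $\varepsilon_0$ and failure probability $\delta_0$, the Boosting Algorithm run with the potential $\phi$ produces a hypothesis $\overline{h}$ such that with probability at least $1-10\delta_0T-10\delta T$, $$\mathrm{corr}_{\mathcal{D}}(\overline{h})\ \ge\ \max_{h\in\mathcal{H}}\mathrm{corr}_{\mathcal{D}}(h)-\frac{2\varepsilon_0}{\gamma}-\varepsilon,$$ while making $T=\mathcal{O}((\log|\mathcal{B}|)/(\gamma^2\varepsilon^2))$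 calls to the weak learning oracle and sampling $TS+S_0=\mathcal{O}((\log|\mathcal{B}|)/(\gamma^3\varepsilon^3))$ labeled examples from $\mathcal{D}$. Here $\mathcal{O}$ suppresses absolute constants and polylogarithmic factors.
   Context: Correlation. For a distribution $\mathcal{D}'$ on $\mathcal{X}\times\{\pm1\}$ and $h:\mathcal{X}\to\{\pm1\}$, $\mathrm{corr}_{\mathcal{D}'}(h)=\mathbb{E}_{(x,y)\sim\mathcal{D}'}[y h(x)]$; for a finite dataset $\widehat D$, $\mathrm{corr}_{\widehat D}(h)$ is the empirical average of $yh(x)$ over $\widehat D$. Weak learner. A learning algorithm $\mathcal{W}$ is a $\gamma$-agnostic weak learner with sample complexity $m:\mathbb{R}_+\times\mathbb{R}_+\to\mathbb{N}\cup\{+\infty\}$ with respect to $\mathcal{H}$ and base class $\mathcal{B}$ if for any $\varepsilon_0,\delta_0>0$, given $m(\varepsilon_0,\delta_0)$ IID samples from any distribution $\mathcal{D}'\in\Delta(\mathcal{X}\times\{\pm1\})$, it outputs $W\in\mathcal{B}$ such that with probability at least $1-\delta_0$, $\mathrm{corr}_{\mathcal{D}'}(W)\ge\gamma\max_{h\in\mathcal{H}}\mathrm{corr}_{\mathcal{D}'}(h)-\varepsilon_0$. ''Fixed tolerance $\varepsilon_0$ and failure probability $\delta_0$'' means it is used with these values. Potential. $\phi(z)=2-z$ for $z\le0$ and $\phi(z)=(z+2)e^{-z}$ for $z>0$. It is $C^2$. Sign. $\mathrm{sign}(f)(x)=+1$ if $f(x)\ge0$ and $-1$ if $f(x)<0$.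 Boosting Algorithm. Inputs: sampling oracle for $\mathcal{D}$, $\gamma$-agnostic weak learner $\mathcal{W}$, step size $\eta$, mixing parameter $\sigma$, number of iterations $T$, per-iteration sample size $S$, resampling parameter $m$, branching tolerance $\tau$, post-selection sample size $S_0$, potential $\phi$. Initialize $H_1=\mathbf{0}$. For $t=1,\dots,T$: (1) Draw $S$ IID examples from $\mathcal{D}$ to form $\widehat D_t$. (2) Define a sampling distribution $\mathcal{D}_t$ on $\mathcal{X}\times\{\pm1\}$. If $t=1$, $\mathcal{D}_1$ is uniform on $\widehat D_1$. If $t>1$, a sample from $\mathcal{D}_t$ is generated as follows: with probability $1-\sigma$ return a sample from $\mathcal{D}_{t-1}$; with probability $\sigma$, draw $\eta'\sim\mathrm{Unif}[0,\eta]$ and $(x,y)$ uniformly from $\widehat D_t$, and return $(x,\hat y)$ where $\hat y=+1$ with probability $p_t(x,y,\eta')$ and $\hat y=-1$ with probability $1-p_t(x,y,\eta')$, with $$p_t(x,y,\eta')=\frac12-\frac{\sigma\,\phi'(yH_{t-1}(x))\,y+\eta\,\phi''\big(y(H_{t-1}(x)+\eta'h_{t-1}(x))\big)\,h_{t-1}(x)}{2(\eta+\sigma)}.$$ (3) Draw $m$ samples from $\mathcal{D}_t$ to form $\widehat D'_t$ (this uses no new examples from $\mathcal{D}$), and call the weak learner to get $W_t=\mathcal{W}(\widehat D'_t)$. (4) If $\mathrm{corr}_{\widehat D'_t}(W_t)>\tau$ set $h_t=W_t/\gamma$; otherwise set $h_t=-\mathrm{sign}(H_t)$. (5) Set $H_{t+1}=H_t+\eta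 h_t$. Finally draw $S_0$ IID examples from $\mathcal{D}$ to form $\widehat D_0$ and output $\overline h\in\arg\max_{h\in\{\mathrm{sign}(H_t):t\in[T]\}}\sum_{(x,y)\in\widehat D_0}yh(x)$.
   Formalization: For small γ (e.g. γ<0.2) p_t(x,y,η') can exceed 1, leaving D_t undefined; runs where some p_t on the drawn data lies outside [0,1] count as successes. The learner's guarantee is assumed for at least m(ε₀,δ₀) samples; m's suppressed factor may be polylogarithmic in |B|. *)

(* Defs.v *)
From HB Require Import structures.
From mathcomp Require Import all_boot all_order all_algebra.
From mathcomp Require Import finmap.
From mathcomp Require Import all_classical all_reals all_analysis.

Set Implicit Arguments.
Unset Strict Implicit.
Unset Printing Implicit Defensive.

Import Order.TTheory GRing.Theory Num.Theory.
Import numFieldNormedType.Exports.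

Local Open Scope classical_set_scope.
Local Open Scope ring_scope.

(* A randomized procedure returning a value in A is represented by its
   expectation functional f |-> E[f].  Only nonnegative (extended-real valued)
   functions f are ever passed to it, so that all the (iterated) integrals
   below are well defined. *)
Definition law (R : realType) (A : Type) : Type := (A -> \bar R) -> \bar R.

Section laws.
Context {R : realType}.

Definition ret {A} (x : A) : law R A := fun f => f x.

Definition bind {A B} (m : law R A) (k : A -> law R B) : law R B :=
  fun f => m (fun x => k x f).

Definition draw {d} {A : measurableType d} (P : probability A R) : law R A :=
  fun f => (\int[P]_x f x)%E.

Definition draw_pmf {A : finType} (p : A -> R) : law R A :=
  fun f => (\sum_(a : A) (p a)%:E * f a)%E.

Definition draw_uniform {A} {n} (s : n.-tuple A) : law R A :=
  fun f => (\sum_(i < n) (n%:R^-1)%:E * f (tnth s i))%E.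

Fixpoint iid {A} (n : nat) (m : law R A) : law R (n.-tuple A) :=
  match n return law R (n.-tuple A) with
  | 0 => ret [tuple]
  | n'.+1 => bind m (fun x => bind (@iid A n' m) (fun s => ret (cons_tuple x s)))
  end.

Definition Prob {A} (m : law R A) (E : set A) : \bar R :=
  m (fun x => (\1_E x)%:E).

End laws.

Arguments iid {R A} n m _.

(* The label set {+1, -1} is encoded by bool: true is +1 and false is -1. *)
Definition pm {R : realType} (b : bool) : R := if b then 1 else -1.

Definition corr {R : realType} {d} {X : measurableType d}
    (D : probability (X * bool)%type R) (h : X -> bool) : R :=
  fine 'E_D[fun z => (pm z.2 * pm (h z.1))%R]%E.

Definition emp_sum {R : realType} {X : Type} {n}
    (s : n.-tuple (X * bool)) (h : X -> bool) : R :=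
  \sum_(i < n) pm (tnth s i).2 * pm (h (tnth s i).1).

Definition emp_corr {R : realType} {X : Type} {n}
    (s : n.-tuple (X * bool)) (h : X -> bool) : R :=
  n%:R^-1 * emp_sum s h.

(* The maximal correlation over a (possibly infinite) nonempty class. *)
Definition max_corr {R : realType} {d} {X : measurableType d}
    (D : probability (X * bool)%type R) (H : set (X -> bool)) : R :=
  sup [set corr D h | h in H].

(* A (possibly randomized) learning algorithm with values in the finite class
   B: on a dataset s of size n it outputs b with probability W n s b. *)
Record learner (R : realType) d (X : measurableType d)
    (B : {fset (X -> bool)}) := Learner {
  learner_pmf :> forall n, n.-tuple (X * bool)%type -> B -> R ;
  learner_ge0 : forall n s b, 0 <= @learner_pmf n s b ;
  learner_sum1 : forall n s, \sum_(b : B) @learner_pmf n s b = 1 ;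
  learner_measurable : forall n b,
    measurable_fun [set: n.-tuple (X * bool)%type]
      (fun s => @learner_pmf n s b) }.

(* The sample complexity takes its values in N + {+oo}, with None for +oo.
   As usual for a sample complexity, the guarantee holds as soon as the learner
   is given at least that many samples. *)
Definition agnostic_weak_learner {R : realType} {d} {X : measurableType d}
    {B : {fset (X -> bool)}} (gamma : R) (H : set (X -> bool))
    (W : learner R B) (mW : R -> R -> option nat) : Prop :=
  forall (eps0 delta0 : R) (m0 n : nat), 0 < eps0 -> 0 < delta0 ->
  mW eps0 delta0 = Some m0 -> (m0 <= n)%N ->
  forall D' : probability (X * bool)%type R,
  ((1 - delta0)%:E <=
   Prob (bind (iid n (draw D')) (fun s => draw_pmf (W n s)))
     [set w : B | (gamma * max_corr D' H - eps0 <= corr D' (val w))%R])%E.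

Definition potential {R : realType} (z : R) : R :=
  if z <= 0 then 2 - z else (z + 2) * expR (- z).

Definition sign {R : realType} {X : Type} (f : X -> R) : X -> bool :=
  fun x => 0 <= f x.

Section boosting.
Context {R : realType} {d : measure_display} {X : measurableType d}.
Context {B : {fset (X -> bool)}}.
Variables (D : probability (X * bool)%type R) (W : learner R B) (gamma : R).
Variables (eta : R) (eta_gt0 : 0 < eta) (sigma tau : R) (T S S0 m : nat).
Variable phi : R -> R.

(* The rounds performed so far, most recent first; round t is recorded as the
   pair of its dataset \hat D_t and of its real-valued hypothesis h_t. *)
Definition history : Type := seq (S.-tuple (X * bool)%type * (X -> R)).

(* On the history of the rounds 1, ..., t this is H_{t+1}. *)
Fixpoint ensemble (hist : history) : X -> R :=
  if hist is r :: hist' then fun x => ensemble hist' x + eta * r.2 x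
  else fun=> 0.

(* p_t(x, y, eta'), with Hp = H_{t-1}, hp = h_{t-1} and z = (x, y). *)
Definition label_prob (Hp hp : X -> R) (z : X * bool) (eta' : R) : R :=
  let y : R := pm z.2 in
  2^-1 - (sigma * phi^`()%classic (y * Hp z.1) * y
          + eta * phi^`(2)%classic (y * (Hp z.1 + eta' * hp z.1)) * hp z.1)
         / (2 * (eta + sigma)).

(* The distribution D_t, where Dt = \hat D_t and hist records the rounds
   1, ..., t-1.  In the recursive case hist' records the rounds 1, ..., t-2,
   so that ensemble hist' = H_{t-1}.  The library's bernoulli_prob p takes a
   default value when p is not in [0, 1], see well_posed below. *)
Fixpoint resample (Dt : S.-tuple (X * bool)%type) (hist : history) :
    law R (X * bool)%type :=
  if hist is (Dp, hp) :: hist' then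
    bind (draw (bernoulli_prob sigma)) (fun fresh : bool =>
    if fresh then
      bind (draw (uniform_prob eta_gt0)) (fun eta' =>
      bind (draw_uniform Dt) (fun z =>
      bind (draw (bernoulli_prob (label_prob (ensemble hist') hp z eta')))
        (fun yhat : bool => ret (z.1, yhat))))
    else resample Dp hist')
  else draw_uniform Dt.

Definition next_hypothesis (hist : history) (D't : m.-tuple (X * bool)%type)
    (w : X -> bool) : X -> R :=
  if tau < emp_corr D't w then fun x => pm (w x) / gamma
  else fun x => - pm (sign (ensemble hist) x).

Fixpoint rounds (n : nat) (hist : history) : law R history :=
  if n is n'.+1 then
    bind (iid S (draw D)) (fun Dt =>
    bind (iid m (resample Dt hist)) (fun D't =>
    bind (draw_pmf (W m D't)) (fun w : B =>
    rounds n' ((Dt, next_hypothesis hist D't (val w)) :: hist))))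
  else ret hist.

(* A run is summarized by its history and the post-selection sample. *)
Definition boost : law R (history * S0.-tuple (X * bool)%type)%type :=
  bind (rounds T [::]) (fun hist =>
  bind (iid S0 (draw D)) (fun D0 => ret (hist, D0))).

(* sign H_1, ..., sign H_T: for a history of T rounds, drop i hist records the
   first T - i of them, hence ensemble (drop i hist) = H_{T-i+1}. *)
Definition candidates (hist : history) : set (X -> bool) :=
  [set sign (ensemble (drop i hist)) | i in [set i | 0 < i <= size hist]%N].

(* The set of all maximizers: no tie-breaking rule is prescribed. *)
Definition outputs (run : history * S0.-tuple (X * bool)%type) :
    set (X -> bool) :=
  [set h | candidates run.1 h /\ forall h', candidates run.1 h' ->
     (emp_sum run.2 h' : R) <= emp_sum run.2 h].

(* The quantities p_t(x, y, eta') used by the run are probabilities.  This is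
   automatic for the potential above, sigma = eta / gamma and
   expR (-1) <= gamma <= 1, since then |phi'| <= 1, |phi''| <= expR (-1) and
   |h_t| <= 1 / gamma.  For small gamma it may fail: with y = 1,
   H_{t-1}(x) = 1/2 and h_{t-1}(x) = - 1 / gamma, the value of p_t(x, y, 0) is
   1/2 + expR (-1/2) / (1 + gamma), which exceeds 1 for gamma < 1/5; the
   sampling step is then undefined. *)
Fixpoint well_posed (hist : history) : Prop :=
  if hist is (Dt, _) :: hist1 then
    (if hist1 is (_, hp) :: hist' then
       forall (i : 'I_S) (eta' : R), 0 <= eta' <= eta ->
       0 <= label_prob (ensemble hist') hp (tnth Dt i) eta' <= 1
     else True) /\ well_posed hist1
  else True.

End boosting.

Arguments boost {R d X B} D W gamma {eta} eta_gt0 sigma tau T S S0 m phi _.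

(* log |B|, with the usual convention that a logarithm in an O(.) is at least
   1 (this only matters for |B| = 1 and |B| = 2). *)
Definition logcard {R : realType} {X : Type} (B : {fset (X -> bool)}) : R :=
  Num.max 1 (ln (#|` B|)%:R).

(* A power of polylog_base is a polylogarithmic factor in 1/gamma, 1/eps,
   1/delta and q; polylog_base >= 1. *)
Definition polylog_base {R : realType} (gamma eps delta q : R) : R :=
  ln (3 + gamma^-1 + eps^-1 + delta^-1 + q).

(* Main.v *)
(** Along a run, [resample] generates labels whose correlation with any
  hypothesis [h] is, up to sampling noise, [sigma / (eta + sigma) =
  1 / (1 + gamma)] times the derivative of the population potential at [H_t]
  in the direction [- h].  The noise [M_t] obeys [M_t = (1 - sigma) M_(t-1) +
  sigma * (centred average of S bounded terms)], so that it is sub-Gaussian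
  with variance of order [sigma / S]: this recycling of old samples is why
  [S] may be as small as [1 / (gamma eps)].

  Smoothness of the potential bounds the sum over the rounds of the decreases
  [descent D H_t h_t].  A round with [h_t = W_t / gamma] decreases the
  potential by more than the average decrease allows; hence some round takes
  [h_t = - sign H_t] with a small decrease.  At that round the weak learner has
  certified that no [h] in the class correlates with the relabelled data, and
  since [- dpotential] is 1 on the mistakes of [sign H_t] and at most 1
  elsewhere, [sign H_t] is nearly optimal.

  The run is analysed backwards, by a lower bound on the expectation functional
  of the remaining rounds in terms of exponential moments of the noise.  These
  moments are products of functions of single samples, so only measurability in
  one sample at a time is ever needed: the other integrands may be
  non-measurable, their integrals being lower integrals. *)

Require Import Defs.
From HB Require Import structures.
From mathcomp Require Import all_boot all_order all_algebra.
From mathcomp Require Import finmap.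
From mathcomp Require Import all_classical all_reals all_analysis.
From mathcomp Require Import measurable_realfun ring lra.

Set Implicit Arguments.
Unset Strict Implicit.
Unset Printing Implicit Defensive.

Import Order.TTheory GRing.Theory Num.Theory.
Import numFieldNormedType.Exports.

Local Open Scope classical_set_scope.
Local Open Scope ring_scope.

(** * The potential *)

Section potential.
Context {R : realType}.
Implicit Types (f g h : R -> R) (x c : R).

(** The difference quotient of [f] at [c] is that of [h] from the right and that of [g] from the
    left; both one-sided limits equal [df]. *)
Lemma is_derive_glue f g h c df :
    (forall x, x <= c -> f x = g x) -> (forall x, c <= x -> f x = h x) ->
  is_derive c 1 g df -> is_derive c 1 h df -> is_derive c 1 f df.
Proof.
move=> fg fh [dg vg] [dh vh].
have cvgE k : derivable k c 1 ->
    (t^-1 *: ((k \o shift c) (t *: (1 : R)) - k c) : R) @[t --> 0^'] --> 'D_1 k c.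
  by move=> dk; exact: dk.
have cf : (t^-1 *: ((f \o shift c) (t *: (1 : R)) - f c) : R) @[t --> 0^'] --> df.
  apply/(@cvg_at_right_left_dnbhs _ R^o).
  - have := cvg_dnbhs_at_right (cvgE _ dh); rewrite vh; apply: cvg_trans.
    apply: near_eq_cvg; near=> t.
    rewrite /= !fh//.
    by rewrite [t%:A]mulr1 lerDr.
  - have := cvg_dnbhs_at_left (cvgE _ dg); rewrite vg; apply: cvg_trans.
    apply: near_eq_cvg; near=> t.
    rewrite /= !fg//.
    by rewrite [t%:A]mulr1 gerDr.
by apply: DeriveDef; [apply/cvg_ex; exists df | apply/cvg_lim].
Unshelve. all: by end_near. Qed.

Lemma is_derive_glueW f g h c (dg dh : R -> R) x :
    (forall x, x <= c -> f x = g x) -> (forall x, c <= x -> f x = h x) ->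
    (forall x, is_derive x 1 g (dg x)) -> (forall x, is_derive x 1 h (dh x)) ->
    dg c = dh c ->
  is_derive x 1 f (if x <= c then dg x else dh x).
Proof.
move=> fg fh Dg Dh dE; case: (ltgtP x c) => [xc|cx|->].
- apply: near_eq_is_derive (Dg x).
  by near=> y; rewrite fg//; apply: ltW; near: y; exact: lt_nbhsl.
- apply: near_eq_is_derive (Dh x).
  by near=> y; rewrite fh//; apply: ltW; near: y; exact: lt_nbhsr.
- by apply: (is_derive_glue fg fh) => //; rewrite dE.
Unshelve. all: by end_near. Qed.

Definition dpotential x : R := if x <= 0 then -1 else - ((x + 1) * expR (- x)).

Definition ddpotential x : R := if x <= 0 then 0 else x * expR (- x).

Lemma is_derive_potential x : is_derive x 1 (@potential R) (dpotential x).
Proof.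
rewrite /dpotential.
apply: (@is_derive_glueW _ (fun y => 2 - y) (fun y => (y + 2) * expR (- y)) 0
  (fun=> -1) (fun y => - ((y + 1) * expR (- y)))).
- by move=> y y0; rewrite /potential y0.
- move=> y y0; rewrite /potential; case: ifPn => // y0'.
  have -> : y = 0 by apply/le_anti; rewrite y0 y0'.
  by rewrite oppr0 expR0; lra.
- by move=> y; apply: is_derive_eq; rewrite ?/GRing.scale/=; ring.
- by move=> y; apply: is_derive_eq; rewrite /GRing.scale/=; ring.
- by rewrite oppr0 expR0; lra.
Qed.

Lemma is_derive_dpotential x : is_derive x 1 dpotential (ddpotential x).
Proof.
rewrite /ddpotential.
apply: (@is_derive_glueW _ (fun=> -1) (fun y => - ((y + 1) * expR (- y))) 0
  (fun=> 0) (fun y => y * expR (- y))).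
- by move=> y y0; rewrite /dpotential y0.
- move=> y y0; rewrite /dpotential; case: ifPn => // y0'.
  have -> : y = 0 by apply/le_anti; rewrite y0 y0'.
  by rewrite oppr0 expR0; lra.
- by move=> y; apply: is_derive_eq; rewrite /GRing.scale/=; ring.
- by rewrite mul0r.
Qed.

Lemma derive1_potential : (@potential R)^`()%classic = dpotential.
Proof.
apply/funext => x; rewrite derive1E.
by have := is_derive_potential x => dx; rewrite derive_val.
Qed.

Lemma derive2_potential : (@potential R)^`(2)%classic = ddpotential.
Proof.
rewrite /derive1n /= derive1_potential; apply/funext => x; rewrite derive1E.
by have := is_derive_dpotential x => dx; rewrite derive_val.
Qed.

Lemma potential_ge0 x : 0 <= potential x.
Proof.
rewrite /potential; case: (lerP x 0) => x0; first lra.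
by rewrite mulr_ge0 ?expR_ge0//; lra.
Qed.

Lemma potential0 : potential (0 : R) = 2.
Proof. by rewrite /potential lexx subr0. Qed.

Lemma mulr_expRN_le1 x y : x <= 1 + y -> x * expR (- y) <= 1.
Proof.
move=> xy; rewrite expRN -ler_pdivlMr ?invr_gt0 ?expR_gt0// invrK mul1r.
exact: le_trans xy (expR_ge1Dx y).
Qed.

Lemma dpotential_le0 x : x <= 0 -> dpotential x = -1.
Proof. by rewrite /dpotential => ->. Qed.

Lemma dpotential_bound x : -1 <= dpotential x <= 0.
Proof.
rewrite /dpotential; case: (lerP x 0) => x0; first lra.
rewrite oppr_le0 mulr_ge0 ?expR_ge0 ?lerN2 ?mulr_expRN_le1//; lra.
Qed.

Lemma ddpotential_bound x : 0 <= ddpotential x <= 1.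
Proof.
rewrite /ddpotential; case: (lerP x 0) => x0; first lra.
by rewrite mulr_ge0 ?expR_ge0 ?mulr_expRN_le1//; lra.
Qed.

Lemma MVT_is_derive f df a b : (forall x, is_derive x 1 f (df x)) ->
  exists2 c, `|c - a| <= `|b - a| & f b - f a = df c * (b - a).
Proof.
move=> fdf; have cf : continuous f.
  by move=> x; apply/differentiable_continuous/derivable1_diffP; exact: ex_derive.
case: (leP a b) => [ab|/ltW ba].
  have [c /[!in_itv]/= /andP[ac cb] E] :=
    @MVT_segment _ f df a b ab (fun x _ => fdf x) (continuous_subspaceT cf).
  by exists c => //; rewrite !ger0_norm ?subr_ge0// lerB.
have [c /[!in_itv]/= /andP[bc ca] E] :=
  @MVT_segment _ f df b a ba (fun x _ => fdf x) (continuous_subspaceT cf).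
exists c; last by rewrite -opprB E; ring.
by rewrite !(distrC _ a) !ger0_norm ?subr_ge0// lerB.
Qed.

Lemma dpotential_lip x y : `|dpotential y - dpotential x| <= `|y - x|.
Proof.
have [c _ ->] := MVT_is_derive x y is_derive_dpotential.
rewrite normrM ler_piMl// ger0_norm; by have /andP[] := ddpotential_bound c.
Qed.

(** The mean value theorem and the Lipschitz bound on [dpotential] give the quadratic term, with
    constant 1 instead of the 1/2 of Taylor's formula. *)
Lemma potential_smooth x t :
  potential (x + t) <= potential x + t * dpotential x + t ^+ 2.
Proof.
have [c] := MVT_is_derive x (x + t) is_derive_potential.
rewrite addrAC subrr add0r => ct /eqP; rewrite subr_eq => /eqP ->.
rewrite [potential x + _]addrC -addrA [potential x + _]addrC addrA lerD2r.
rewrite -lerBlDl mulrC -mulrBr expr2.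
apply: le_trans (ler_norm _) _; rewrite normrM.
rewrite -[t * t]ger0_norm -?expr2 ?sqr_ge0// expr2 normrM ler_wpM2l//.
exact: le_trans (dpotential_lip _ _) ct.
Qed.

Lemma continuous_dpotential : continuous dpotential.
Proof.
move=> x; apply/differentiable_continuous/derivable1_diffP.
by have := is_derive_dpotential x => dx; exact: ex_derive.
Qed.

Lemma continuous_ddpotential : continuous ddpotential.
Proof.
(* Written through max(x, 0), the two-piece formula becomes a composition of continuous
   functions. *)
have -> : ddpotential = (fun x => Num.max x 0 * expR (- Num.max x 0)).
  apply/funext => x; rewrite /ddpotential; case: (leP x 0) => x0.
    by rewrite mul0r.
  by [].
have cm : continuous (fun x : R => Num.max x 0).
  by move=> x; apply: continuous_max => //; exact: cvg_cst.
move=> x; apply: cvgM; first exact: cm.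
apply: (@continuous_comp _ _ _ (fun x => - Num.max x 0) expR); last exact: continuous_expR.
by apply: cvgN; exact: cm.
Qed.

End potential.

(** * Expectation functionals *)

Section laws.
Context {R : realType}.
Local Open Scope ereal_scope.

(* [law_le] has no measurability hypothesis: [draw] is a lower integral on
   nonnegative functions. *)
Record monotone_law {A} (m : law R A) : Prop := MonotoneLaw {
  law_le : forall f g, (forall x, 0 <= f x) -> (forall x, f x <= g x) ->
    m f <= m g ;
  law_cst1 : m (fun=> 1) = 1 ;
  law_ge0 : forall f, (forall x, 0 <= f x) -> 0 <= m f }.

Lemma monotone_ret {A} (x : A) : monotone_law (@ret R A x).
Proof. by split => [f g _ fg| |f f0]; rewrite /ret. Qed.

Lemma monotone_bind {A B} (m : law R A) (k : A -> law R B) :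
  monotone_law m -> (forall x, monotone_law (k x)) -> monotone_law (bind m k).
Proof.
move=> mm mk; rewrite /bind; split.
- move=> f g f0 fg; apply: (law_le mm) => x; first exact: (law_ge0 (mk x)).
  exact: (law_le (mk x)).
- rewrite -[RHS](law_cst1 mm); congr m; apply/funext => x.
  exact: law_cst1 (mk x).
- by move=> f f0; apply: (law_ge0 mm) => x; exact: (law_ge0 (mk x)).
Qed.

Lemma monotone_draw d (A : measurableType d) (P : probability A R) :
  monotone_law (draw P).
Proof.
split; rewrite /draw.
- move=> f g f0 fg; have g0 x : 0 <= g x by exact: le_trans (fg x).
  rewrite !ge0_integralTE//; apply: ereal_sup_le => _ [h /= hf <-].
  by exists h => //= x; exact: le_trans (fg x).
- by rewrite integral_cst// mul1e; exact: probability_setT.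
- by move=> f f0; apply: integral_ge0.
Qed.

Lemma monotone_draw_pmf (A : finType) (p : A -> R) : (forall a, 0 <= p a)%R ->
  (\sum_a p a = 1)%R -> monotone_law (draw_pmf p).
Proof.
move=> p0 p1; rewrite /draw_pmf; split.
- by move=> f g f0 fg; apply: lee_sum => a _; rewrite lee_wpmul2l ?lee_fin.
- by under eq_bigr do rewrite mule1; rewrite sumEFin p1.
- by move=> f f0; apply: sume_ge0 => a _; rewrite mule_ge0 ?lee_fin.
Qed.

Lemma monotone_draw_uniform A n (s : n.-tuple A) : (0 < n)%N ->
  monotone_law (@draw_uniform R A n s).
Proof.
move=> n0; rewrite /draw_uniform; split.
- by move=> f g f0 fg; apply: lee_sum => a _; rewrite lee_wpmul2l ?lee_fin.
- under eq_bigr do rewrite mule1.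
  by rewrite sumEFin sumr_const card_ord -[X in X%:E]mulr_natr mulVf ?pnatr_eq0 -?lt0n.
- by move=> f f0; apply: sume_ge0 => a _; rewrite mule_ge0 ?lee_fin.
Qed.

Lemma monotone_iid A n (m : law R A) : monotone_law m -> monotone_law (iid n m).
Proof.
move=> mm; elim: n => [|n IH] /=; first exact: monotone_ret.
by do 2 (apply: monotone_bind => // ?); exact: monotone_ret.
Qed.

(** The laws are exchanged one sample at a time. This carries the weak learner's guarantee from
    [draw P] to a finitely supported law, which may be strictly larger on non-measurable
    functions. *)
Lemma le_iid A n (m1 m2 : law R A) (f : n.-tuple A -> \bar R) :
    monotone_law m1 -> monotone_law m2 ->
    (forall g, (forall x, 0 <= g x) -> m1 g <= m2 g) ->
    (forall s, 0 <= f s) ->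
  iid n m1 f <= iid n m2 f.
Proof.
move=> mm1 mm2 m12; elim: n f => [|n IH] f f0 //=.
rewrite /bind /ret.
apply: (@le_trans _ _ (m1 (fun x => iid n m2 (fun s => f (cons_tuple x s))))).
  apply: (law_le mm1) => x; last exact: IH.
  exact: (law_ge0 (monotone_iid n mm1)).
by apply: m12 => x; exact: (law_ge0 (monotone_iid n mm2)).
Qed.

(** Additivity is asked for all nonnegative functions, measurable or not. Finitely supported laws
    have it, whereas a lower integral is in general only superadditive. *)
Definition additive_law {A} (m : law R A) : Prop := forall f g,
  (forall x, 0 <= f x) -> (forall x, 0 <= g x) ->
  m (fun x => f x + g x) = m f + m g.

Lemma additive_iid A n (m : law R A) :
  monotone_law m -> additive_law m -> additive_law (iid n m).
Proof.
move=> mm am; elim: n => [|n IH] f g f0 g0 //=; rewrite /bind /ret.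
rewrite -am; last 2 first.
  by move=> x; exact: (law_ge0 (monotone_iid n mm)).
  by move=> x; exact: (law_ge0 (monotone_iid n mm)).
by congr m; apply/funext => x; rewrite IH.
Qed.

Lemma additive_law_sum A (m : law R A) I (r : seq I) (f : I -> A -> \bar R) :
    additive_law m -> m (fun=> 0) = 0 -> (forall i x, 0 <= f i x) ->
  m (fun x => \sum_(i <- r) f i x) = \sum_(i <- r) m (f i).
Proof.
move=> am m0 f0; elim: r => [|i r IH].
  by rewrite big_nil -[RHS]m0; congr m; apply/funext => x; rewrite big_nil.
rewrite big_cons -IH -am//; last by move=> x; exact: sume_ge0.
by congr m; apply/funext => x; rewrite big_cons.
Qed.

(** The prefactor [c] makes the induction work: it absorbs the value of [g] at the first sample
    before the remaining ones are integrated. *)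
Lemma iid_prod A n (m : law R A) (g : A -> R) (c e : R) : (0 <= c)%R ->
    (forall x, 0 <= g x)%R ->
    (forall a : R, (0 <= a)%R -> m (fun x => (a * g x)%:E) = (a * e)%:E) ->
    (0 <= e)%R ->
  iid n m (fun s => (c * \prod_(i < n) g (tnth s i))%:E) = (c * e ^+ n)%:E.
Proof.
move=> c0 g0 me e0; elim: n c c0 => [|n IH] c c0 /=.
  by rewrite /ret big_ord0 expr0.
rewrite /bind /ret; transitivity (m (fun x => (c * e ^+ n * g x)%:E)).
  congr m; apply/funext => x; rewrite mulrAC -IH ?mulr_ge0//.
  congr (iid n m _); apply/funext => s; congr EFin.
  rewrite big_ord_recl tnth0 mulrA; congr (_ * _)%R.
  by apply: eq_bigr => i _; rewrite tnthS.
by rewrite me ?mulr_ge0 ?exprn_ge0// exprSr mulrA.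
Qed.

Definition atomic_law {A} (l : seq (R * A)) : law R A :=
  fun f => \sum_(a <- l) a.1%:E * f a.2.

Lemma additive_atomic_law A (l : seq (R * A)) :
  all (fun a => 0 <= a.1)%R l -> additive_law (atomic_law l).
Proof.
move=> l0 f g f0 g0; rewrite /atomic_law -big_split/=.
by apply: eq_bigr => a _; rewrite ge0_muleDr.
Qed.

End laws.

(** * Bounded measurable functions and lower bounds on iterated integrals *)

Section bounded_measurable.
Context {R : realType} d {Z : measurableType d}.
Implicit Types (f g u : Z -> R) (P : probability Z R).

Definition bmf f := measurable_fun setT f /\ exists M, forall z, `|f z| <= M.

Definition Ex P f : R := Rintegral P setT f.

Lemma bmf_cst (c : R) : bmf (fun=> c).
Proof. by split => //; exists `|c|. Qed.

Lemma bmfD f g : bmf f -> bmf g -> bmf (fun z => f z + g z).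
Proof.
move=> [mf [M fM]] [mg [N gN]]; split; first exact: measurable_funD.
by exists (M + N) => z; apply: le_trans (ler_normD _ _) _; exact: lerD.
Qed.

Lemma bmfM f g : bmf f -> bmf g -> bmf (fun z => f z * g z).
Proof.
move=> [mf [M fM]] [mg [N gN]]; split; first exact: measurable_funM.
by exists (M * N) => z; rewrite normrM ler_pM.
Qed.

Lemma bmfN f : bmf f -> bmf (fun z => - f z).
Proof.
move=> [mf [M fM]]; split; first exact: measurableT_comp.
by exists M => z; rewrite normrN.
Qed.

Lemma bmfB f g : bmf f -> bmf g -> bmf (fun z => f z - g z).
Proof. by move=> bf /bmfN; exact: bmfD. Qed.

Lemma bmfZ (c : R) f : bmf f -> bmf (fun z => c * f z).
Proof. by move=> bf; apply: bmfM => //; exact: bmf_cst. Qed.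

Lemma bmf_sum I (r : seq I) (f : I -> Z -> R) :
  (forall i, bmf (f i)) -> bmf (fun z => \sum_(i <- r) f i z).
Proof.
move=> bf; elim: r => [|i r IH].
  by under eq_fun do rewrite big_nil; exact: bmf_cst.
by under eq_fun do rewrite big_cons; exact: bmfD.
Qed.

Lemma bmf_comp (phi : R -> R) f : continuous phi -> bmf f ->
  (forall M, exists N, forall x, `|x| <= M -> `|phi x| <= N) ->
  bmf (fun z => phi (f z)).
Proof.
move=> cphi [mf [M fM]] /(_ M)[N phiN]; split.
  exact: measurableT_comp (continuous_measurable_fun cphi) mf.
by exists N => z; exact: phiN.
Qed.

Lemma bmf_expR f : bmf f -> bmf (fun z => expR (f z)).
Proof.
move=> bf; apply: bmf_comp bf _ => [|M]; first exact: continuous_expR.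
exists (expR M) => x xM; rewrite ger0_norm ?expR_ge0// ler_expR.
exact: le_trans (ler_norm _) xM.
Qed.

Lemma bmf_integrable P f : bmf f -> P.-integrable setT (EFin \o f).
Proof.
move=> [mf [M fM]]; apply: (@le_integrable _ _ _ _ _ _ _ (cst M%:E)) => //.
- exact/measurable_EFinP.
- by move=> z _ /=; rewrite lee_fin (le_trans (fM z))// ler_norm.
- exact: finite_measure_integrable_cst.
Qed.

Lemma ExE P f : bmf f -> (\int[P]_z (f z)%:E = (Ex P f)%:E)%E.
Proof.
move=> bf; rewrite /Ex /Rintegral fineK//.
by have := integrable_fin_num measurableT (bmf_integrable P bf); apply.
Qed.

Lemma Ex_cst P (c : R) : Ex P (fun=> c) = c.
Proof. by rewrite /Ex Rintegral_cst// [X in fine X](probability_setT P) mulr1. Qed.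

Lemma ExD P f g : bmf f -> bmf g -> Ex P (fun z => f z + g z) = Ex P f + Ex P g.
Proof. by move=> bf bg; rewrite /Ex RintegralD//; exact: bmf_integrable. Qed.

Lemma ExZ P (c : R) f : bmf f -> Ex P (fun z => c * f z) = c * Ex P f.
Proof. by move=> bf; rewrite /Ex RintegralZl//; exact: bmf_integrable. Qed.

Lemma ExN P f : bmf f -> Ex P (fun z => - f z) = - Ex P f.
Proof.
move=> bf; rewrite -mulN1r -ExZ//; congr (Ex P _).
by apply/funext => z; rewrite mulN1r.
Qed.

Lemma ExB P f g : bmf f -> bmf g -> Ex P (fun z => f z - g z) = Ex P f - Ex P g.
Proof. by move=> bf bg; rewrite ExD ?ExN//; exact: bmfN. Qed.

Lemma Ex_sum P I (r : seq I) (f : I -> Z -> R) : (forall i, bmf (f i)) ->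
  Ex P (fun z => \sum_(i <- r) f i z) = \sum_(i <- r) Ex P (f i).
Proof.
move=> bf; elim: r => [|i r IH].
  by under eq_fun do rewrite big_nil; rewrite big_nil Ex_cst.
under eq_fun do rewrite big_cons.
by rewrite big_cons ExD ?IH//; exact: bmf_sum.
Qed.

Lemma le_Ex P f g : bmf f -> bmf g -> (forall z, f z <= g z) -> Ex P f <= Ex P g.
Proof. by move=> bf bg fg; apply: le_Rintegral => //; exact: bmf_integrable. Qed.

Lemma Ex_ge0 P f : (forall z, 0 <= f z) -> 0 <= Ex P f.
Proof. by move=> f0; exact: Rintegral_ge0. Qed.

Lemma Ex_bound P f (b : R) : bmf f -> (forall z, `|f z| <= b) -> `|Ex P f| <= b.
Proof.
move=> bf fb; rewrite ler_norml -{1}(Ex_cst P (- b)) -{2}(Ex_cst P b).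
by apply/andP; split; apply: le_Ex => //; (try exact: bmf_cst) => z;
  have := fb z; rewrite ler_norml => /andP[].
Qed.

(** Inverting exp(-x) >= 1 - x gives exp(x) <= 1 / (1 - x), and (1 + x + 2 x^2)(1 - x) - 1 = x^2 (1
    - 2x) is nonnegative for x <= 1/2. *)
Lemma expR_le_quadratic (x : R) : x <= 2^-1 -> expR x <= 1 + x + 2 * x ^+ 2.
Proof.
move=> x2; have x1 : 0 < 1 - x by lra.
apply: (@le_trans _ _ (1 - x)^-1).
  by rewrite -[x in expR x]opprK expRN lef_pV2 ?posrE ?expR_gt0// expR_ge1Dx.
rewrite -[leLHS]mul1r ler_pdivrMr// -subr_ge0.
have -> : (1 + x + 2 * x ^+ 2) * (1 - x) - 1 = x ^+ 2 * (1 - 2 * x) by ring.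
by rewrite mulr_ge0 ?sqr_ge0//; lra.
Qed.

(** The centred variable is at most 2b <= 1/2 in absolute value, so the quadratic bound on the
    exponential applies. Its linear term has mean zero and its quadratic term is at most 2 (2b)^2 =
    8 b^2. *)
Lemma mgf_bound P u (b : R) : bmf u -> (forall z, `|u z| <= b) -> b <= 4^-1 ->
  Ex P (fun z => expR (u z - Ex P u)) <= expR (8 * b ^+ 2).
Proof.
move=> bu ub b4; have Eb := Ex_bound P bu ub.
have bc : bmf (fun z => u z - Ex P u) by apply: bmfB => //; exact: bmf_cst.
apply: (@le_trans _ _ (Ex P (fun z => (1 + 8 * b ^+ 2) + (u z - Ex P u)))).
  apply: le_Ex.
  - exact: bmf_expR.
  - by apply: bmfD => //; exact: bmf_cst.
  - move=> z; have zb : `|u z - Ex P u| <= 2 * b.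
      by apply: le_trans (ler_normB _ _) _; rewrite mulr_natl mulr2n lerD.
    have b0 : 0 <= b by exact: le_trans (normr_ge0 _) (ub z).
    apply: le_trans (expR_le_quadratic _) _.
      by apply: le_trans (ler_norm _) _; lra.
    rewrite addrAC lerD2r lerD2l -[X in 2 * X]real_normK ?num_real//.
    have -> : 8 * b ^+ 2 = 2 * (2 * b) ^+ 2 by ring.
    by rewrite ler_wpM2l// lerXn2r// nnegrE ?mulr_ge0.
rewrite ExD//; last exact: bmf_cst.
rewrite ExB//; last exact: bmf_cst.
by rewrite !Ex_cst subrr addr0 expR_ge1Dx.
Qed.

(** Since [f] may be non-measurable, only monotonicity is available, and for nonnegative functions
    only; hence the passage through the positive part of [q]. *)
Lemma draw_lower_bound P (f : Z -> \bar R) (q : Z -> R) : bmf q ->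
    (forall x, 0 <= f x)%E -> (forall x, (q x)%:E <= f x)%E ->
  ((Ex P q)%:E <= draw P f)%E.
Proof.
move=> bq f0 qf.
have bq0 : bmf (fun z => Num.max (q z) 0).
  case: bq => mq [M qM]; split.
    by apply: measurable_maxr.
  exists M => z; rewrite ger0_norm ?le_max ?lexx ?orbT// ge_max.
  by rewrite (le_trans _ (qM z)) ?ler_norm//= (le_trans _ (qM z)).
apply: (@le_trans _ _ (draw P (fun z => (Num.max (q z) 0)%:E))).
  rewrite /draw ExE// lee_fin; apply: le_Ex => // z.
  by rewrite le_max lexx.
apply: (law_le (monotone_draw P)) => z; first by rewrite lee_fin le_max lexx orbT.
by rewrite EFin_max ge_max qf f0.
Qed.

(** A constant minus a combination of products keeps its form when samples are integrated out:
    fixing the first sample [x] turns the coefficient [c k] into [c k * g k x]. Thus [f] itself is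
    never integrated as a function on the product space, only minorized one coordinate at a time. *)
Lemma iid_lower_bound P n I (r : seq I) (a : R) (c : I -> R) (g : I -> Z -> R)
    (f : n.-tuple Z -> \bar R) :
    (forall k, bmf (g k)) -> (forall s, 0 <= f s)%E ->
    (forall s, (a - \sum_(k <- r) c k * \prod_(i < n) g k (tnth s i))%:E
                 <= f s)%E ->
  ((a - \sum_(k <- r) c k * Ex P (g k) ^+ n)%:E <= iid n (draw P) f)%E.
Proof.
move=> bg; elim: n c f => [|n IH] c f f0 fE /=.
  rewrite /ret; apply: le_trans (fE [tuple]).
  by rewrite lee_fin lerD2l lerN2; apply: ler_sum => k _; rewrite big_ord0.
rewrite /bind /ret.
have bq k : bmf (fun x => c k * Ex P (g k) ^+ n * g k x) by exact: bmfZ.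
have -> : a - \sum_(k <- r) c k * Ex P (g k) ^+ n.+1 =
    Ex P (fun x => a - \sum_(k <- r) c k * Ex P (g k) ^+ n * g k x).
  rewrite ExB; [|exact: bmf_cst|exact: bmf_sum].
  rewrite Ex_cst Ex_sum//; congr (_ - _); apply: eq_bigr => k _.
  by rewrite ExZ// exprSr mulrA.
apply: draw_lower_bound => [|x|x].
- by apply: bmfB; [exact: bmf_cst|exact: bmf_sum].
- exact: (law_ge0 (monotone_iid n (monotone_draw P))).
- under eq_bigr do rewrite mulrAC.
  apply: IH => // s; apply: le_trans (fE _).
  rewrite lee_fin lerD2l lerN2; apply: ler_sum => k _.
  rewrite big_ord_recl tnth0 mulrA le_eqVlt; apply/orP; left; apply/eqP.
  by congr (_ * _); apply: eq_bigr => i _; rewrite tnthS.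
Qed.

End bounded_measurable.

(** * Finitely supported probability measures *)

Section atomic_probability.
Context {R : realType} d {Z : measurableType d}.
Implicit Types (l : seq (R * Z)).

Lemma atomic_measure l : all (fun a => 0 <= a.1) l ->
  exists mu : {measure set Z -> \bar R}, forall f : Z -> \bar R,
    measurable_fun setT f -> (forall x, 0 <= f x)%E ->
    (\int[mu]_x f x = atomic_law l f)%E.
Proof.
elim: l => [_|a l IH /= /andP[a0 /IH[mu muE]]].
  by exists mzero => f _ _; rewrite integral_measure_zero /atomic_law big_nil.
exists (measure_add (mscale (NngNum a0) (dirac a.2)) mu) => f mf f0.
rewrite ge0_integral_measure_add// ge0_integral_mscale// integral_dirac//.
by rewrite diracT mul1e muE// /atomic_law big_cons.
Qed.

Import HBNNSimple.

(** The weak learner's guarantee speaks of a probability measure, so the atoms have to be packaged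
    as one. For non-measurable [f] only an inequality holds: [draw P f] is a supremum over simple
    functions below [f], each of which integrates to its atomic sum. *)
Lemma atomic_probability l : all (fun a => 0 <= a.1) l ->
    \sum_(a <- l) a.1 = 1 ->
  exists P : probability Z R,
    (forall f : Z -> R, bmf f -> Ex P f = \sum_(a <- l) a.1 * f a.2) /\
    (forall f : Z -> \bar R, (forall x, 0 <= f x)%E ->
       (draw P f <= atomic_law l f)%E).
Proof.
move=> l0 l1; have [mu muE] := atomic_measure l0.
have mu1 : mu setT = 1%E.
  have := integral_cst mu measurableT 1%E; rewrite mul1e => <-.
  rewrite muE// /atomic_law; under eq_bigr do rewrite mule1.
  by rewrite sumEFin l1.
(* As [mu] has mass 1, normalization leaves it unchanged and only equips it with the structure of a
   probability; [dirac point] is the default for degenerate masses. *)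
pose P : probability Z R := mnormalize mu (dirac point).
have muP A : measurable A -> mu A = P A.
  by move=> _; rewrite /P /= /mnormalize mu1 onee_eq0 /= invr1 mule1.
have PE f : measurable_fun setT f -> (forall x, 0 <= f x)%E ->
  (\int[P]_x f x = atomic_law l f)%E.
  move=> mf f0; rewrite -muE//; apply: eq_measure_integral => A mA _.
  by rewrite muP.
exists P; split => [f bf|f f0].
  have [mf [M fM]] := bf.
  (* Shifting by the bound [M] reduces the signed case to the nonnegative one. *)
  have M0 z : 0 <= f z + M by have := fM z; rewrite ler_norml => /andP[]; lra.
  have bfM : bmf (fun z => f z + M) by apply: bmfD => //; exact: bmf_cst.
  have : Ex P (fun z => f z + M) = \sum_(a <- l) a.1 * (f a.2 + M).
    apply: EFin_inj; rewrite -ExE// PE.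
    - by rewrite /atomic_law -sumEFin.
    - by apply/measurable_EFinP; case: bfM.
    - by move=> z; rewrite lee_fin.
  rewrite ExD//; last exact: bmf_cst.
  rewrite Ex_cst; under [RHS]eq_bigr do rewrite mulrDr.
  by rewrite big_split/= -mulr_suml l1 mul1r => /addIr.
rewrite /draw ge0_integralTE//; apply: ge_ereal_sup => _ [h /= hf <-].
have -> : sintegral P h = atomic_law l (EFin \o h).
  rewrite -integralT_nnsfun PE//; first exact/measurable_EFinP.
  by move=> x; rewrite lee_fin.
rewrite /atomic_law !big_seq; apply: lee_sum => a al.
by apply: lee_wpmul2l; [rewrite lee_fin; exact: (allP l0)|exact: hf].
Qed.

End atomic_probability.

(** * The resampling distribution *)

Section integrated_label.
Context {R : realType}.
Implicit Types (f F : R -> R).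

Lemma integral_is_derive f F (a b : R) : a < b -> continuous f ->
    (forall x : R, is_derive x 1 F (f x)) ->
  (\int[lebesgue_measure]_(x in `[a, b]) (f x)%:E = (F b - F a)%:E)%E.
Proof.
move=> ab cf DF.
have cF : continuous F.
  by move=> x; apply/differentiable_continuous/derivable1_diffP; exact: ex_derive.
rewrite (@continuous_FTC2 _ f F) ?EFinB//.
- exact: continuous_subspaceT.
- split; [by move=> x _; exact: ex_derive| |].
  + by apply: cvg_at_right_filter; exact: cF.
  + by apply: cvg_at_left_filter; exact: cF.
- by move=> x _; rewrite derive1E; exact: derive_val.
Qed.

Context d {X : measurableType d}.
Variables (eta : R) (eta_gt0 : 0 < eta) (sigma : R).
Implicit Types (H h : X -> R) (z : X * bool).

(* The average of [label_prob] over [eta'] uniform in [[0, eta]]: the second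
   derivative integrates to a difference of first derivatives. *)
Definition mean_label H h z : R :=
  2^-1 - pm z.2 * (dpotential (pm z.2 * (H z.1 + eta * h z.1))
                   - (1 - sigma) * dpotential (pm z.2 * H z.1))
         / (2 * (eta + sigma)).

Lemma pm_sqr (b : bool) : pm b * pm b = 1 :> R.
Proof. by case: b; rewrite /pm ?mulrNN mulr1. Qed.

Lemma normr_pm (b : bool) : `|pm b : R| = 1.
Proof. by case: b; rewrite /pm ?normrN normr1. Qed.

Let lp H h z := label_prob eta sigma (@potential R) H h z.

(** An antiderivative of the label probability in [t]. The chain rule produces a factor [pm z.2],
    which the one placed in front of [dpotential] cancels. *)
Let LP H h z (t : R) : R :=
  t / 2 - (sigma * dpotential (pm z.2 * H z.1) * pm z.2 * t
           + eta * (pm z.2 * dpotential (pm z.2 * (H z.1 + t * h z.1))))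
          / (2 * (eta + sigma)).

Lemma label_probE H h z t : lp H h z t =
  2^-1 - (sigma * dpotential (pm z.2 * H z.1) * pm z.2
          + eta * ddpotential (pm z.2 * (H z.1 + t * h z.1)) * h z.1)
         / (2 * (eta + sigma)).
Proof. by rewrite /lp /label_prob derive1_potential derive2_potential. Qed.

Lemma continuous_label_prob H h z : continuous (lp H h z).
Proof.
rewrite (funext (label_probE H h z)).
have cline : continuous (fun t : R => pm z.2 * (H z.1 + t * h z.1)).
  by move=> t; apply: cvgM; [exact: cvg_cst|apply: cvgD; [exact: cvg_cst|
     apply: cvgM; [exact: cvg_id|exact: cvg_cst]]].
move=> t; apply: cvgB; first exact: cvg_cst.
apply: cvgM; last exact: cvg_cst.
apply: cvgD; first exact: cvg_cst.
apply: cvgM; last exact: cvg_cst.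
apply: cvgM; first exact: cvg_cst.
apply: (@continuous_comp _ _ _ (fun t : R => pm z.2 * (H z.1 + t * h z.1)) ddpotential); first exact: cline.
exact: continuous_ddpotential.
Qed.

Let is_derive_LP H h z (t : R) : is_derive t 1 (LP H h z) (lp H h z t).
Proof.
rewrite label_probE /LP.
have D : is_derive t 1 (fun t => dpotential (pm z.2 * (H z.1 + t * h z.1)))
    (ddpotential (pm z.2 * (H z.1 + t * h z.1)) * (pm z.2 * h z.1)).
  apply: (@is_derive1_comp _ dpotential (fun t => pm z.2 * (H z.1 + t * h z.1)) t).
    exact: is_derive_dpotential.
  by apply: is_derive_eq; rewrite /GRing.scale/=; ring.
have y2 := pm_sqr z.2.
apply: is_derive_eq; rewrite /GRing.scale/=.
rewrite (_ : pm z.2 * (_ * (pm z.2 * h z.1)) =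
  pm z.2 * pm z.2 * (ddpotential (pm z.2 * (H z.1 + t * h z.1)) * h z.1)); last by ring.
by rewrite y2; ring.
Qed.

Let LP_mean H h z : LP H h z eta - LP H h z 0 = eta * mean_label H h z.
Proof. by rewrite /LP /mean_label !mul0r addr0; ring. Qed.

Lemma integral_label_prob H h z :
  (\int[lebesgue_measure]_(t in `[0%R, eta]) (lp H h z t)%:E
   = (eta * mean_label H h z)%:E)%E.
Proof.
rewrite (integral_is_derive eta_gt0 (@continuous_label_prob H h z) (is_derive_LP H h z)).
by rewrite LP_mean.
Qed.

Lemma integral_label_probC H h z :
  (\int[lebesgue_measure]_(t in `[0%R, eta]) (1 - lp H h z t)%:E
   = (eta * (1 - mean_label H h z))%:E)%E.
Proof.
have D t : is_derive (t : R) 1 (fun t => t - LP H h z t) (1 - lp H h z t).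
  by have := is_derive_LP H h z t => ?; apply: is_derive_eq.
have C : continuous (fun t => 1 - lp H h z t).
  by move=> t; apply: cvgB; [exact: cvg_cst|exact: continuous_label_prob].
rewrite (integral_is_derive eta_gt0 C D).
by congr EFin; have := LP_mean H h z => E; rewrite mulrBr -E; ring.
Qed.

(** Outside [0, 1], the default of [bernoulli_prob] agrees with the parameter 0; this makes
    [draw_bernoulli] valid for every [p]. *)
Definition unit_or0 (p : R) : R := if 0 <= p <= 1 then p else 0.

Lemma draw_bernoulli (p : R) (f : bool -> \bar R) : (forall b, 0 <= f b)%E ->
  (draw (bernoulli_prob p) f =
     (unit_or0 p)%:E * f true + (1 - unit_or0 p)%:E * f false)%E.
Proof.
rewrite /unit_or0; move=> f0 /=; rewrite /draw; case: ifPn => p01; first by rewrite integral_bernoulli_prob.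
rewrite -[in RHS](@integral_bernoulli_prob _ 0) ?lexx ?ler01//.
apply: eq_measure_integral => A mA _ /=.
rewrite /= /bernoulli_prob (negbTE p01) lexx ler01/=.
rewrite -[LHS](_ : bernoulli_prob 0 A = _).
  by rewrite /bernoulli_prob lexx ler01.
by rewrite bernoulli_probE ?lexx ?ler01// mul0e add0e [X in (X * _)%E](_ : _ = 1%E) ?mul1e//; congr EFin; exact: subr0.
Qed.

Lemma draw_uniform_label I (r : seq I) H h (z : I -> X * bool) (c : R)
    (f : I -> bool -> \bar R) : 0 <= c ->
    (forall i t, 0 <= t <= eta -> 0 <= lp H h (z i) t <= 1) ->
    (forall i b, 0 <= f i b)%E ->
  (draw (uniform_prob eta_gt0) (fun t => \sum_(i <- r)
     c%:E * draw (bernoulli_prob (lp H h (z i) t)) (f i)) =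
   \sum_(i <- r) c%:E * ((mean_label H h (z i))%:E * f i true
                         + (1 - mean_label H h (z i))%:E * f i false))%E.
Proof.
move=> c0 lp01 f0.
(* The label probability is controlled on [0, [eta]] only. Truncation gives an integrand that is
   measurable and nonnegative on the whole line, and changes nothing on that interval. *)
pose q i t := unit_or0 (lp H h (z i) t).
have mlp i : measurable_fun setT (lp H h (z i)).
  exact: continuous_measurable_fun (@continuous_label_prob H h (z i)).
have mq i : measurable_fun setT (q i).
  apply: measurable_fun_ifT => //; apply: measurable_and.
    by apply: measurable_fun_ler.
  by apply: measurable_fun_ler.
have q01 i t : 0 <= q i t <= 1 by rewrite /q /unit_or0; case: ifPn; rewrite ?lexx ?ler01.
pose F i t := ((q i t)%:E * f i true + (1 - q i t)%:E * f i false)%E.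
have F0 i t : (0 <= F i t)%E.
  have /andP[? ?] := q01 i t.
  by rewrite adde_ge0// mule_ge0// lee_fin// subr_ge0.
have mF i : measurable_fun setT (F i).
  apply: emeasurable_funD; apply: emeasurable_funM => //; apply/measurable_EFinP => //.
  by apply: measurable_funB.
have mcF i : measurable_fun setT (fun t => (c%:E * F i t)%E).
  by apply: emeasurable_funM => //; exact: mF.
have -> : (fun t => \sum_(i <- r) c%:E * draw (bernoulli_prob (lp H h (z i) t)) (f i))%E
    = (fun t => \sum_(i <- r) c%:E * F i t)%E.
  by apply/funext => t; apply: eq_bigr => i _; rewrite draw_bernoulli.
rewrite /draw integral_uniform; last 2 first.
- by apply: emeasurable_sum => i; exact: mcF.
- by move=> t; apply: sume_ge0 => i _; rewrite mule_ge0.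
rewrite ge0_integral_sum//; last 2 first.
- by move=> i; apply: measurable_funTS; exact: mcF.
- by move=> i t _; rewrite mule_ge0.
rewrite ge0_sume_distrr//; last first.
  by move=> i _; apply: integral_ge0 => t _; rewrite mule_ge0.
apply: eq_bigr => i _; rewrite ge0_integralZl//; [|exact: measurable_funTS (mF i)].
rewrite muleCA; congr (_ * _)%E.
have -> : (\int[lebesgue_measure]_(t in `[0%R, eta]) F i t =
   \int[lebesgue_measure]_(t in `[0%R, eta])
     ((lp H h (z i) t)%:E * f i true + (1 - lp H h (z i) t)%:E * f i false))%E.
  apply: eq_integral => t; rewrite inE/= in_itv/= => t01.
  by rewrite /F /q /unit_or0 lp01.
pose D : set R := `[0%R, eta]%classic.
have mp : measurable_fun D (fun t => (lp H h (z i) t)%:E).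
  by apply: measurable_funTS; exact/measurable_EFinP.
have mpC : measurable_fun D (fun t => (1 - lp H h (z i) t)%:E).
  by apply: measurable_funTS; apply/measurable_EFinP; exact: measurable_funB.
have p0 t : D t -> (0 <= (lp H h (z i) t)%:E)%E.
  by rewrite /D/= in_itv/= => /(lp01 i)/andP[]; rewrite lee_fin.
have pC0 t : D t -> (0 <= (1 - lp H h (z i) t)%:E)%E.
  by rewrite /D/= in_itv/= => /(lp01 i)/andP[_]; rewrite lee_fin subr_ge0.
have mcst k : measurable_fun D (cst k : R -> \bar R) by exact: measurable_cst.
rewrite (@ge0_integralD _ _ _ lebesgue_measure D) //=; last first.
- exact: emeasurable_funM mpC (mcst _).
- by move=> t Dt; rewrite mule_ge0// pC0.
- exact: emeasurable_funM mp (mcst _).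
- by move=> t Dt; rewrite mule_ge0// p0.
- exact: measurable_itv.
have mD : measurable D by exact: measurable_itv.
transitivity ((eta - 0)^-1%:E * ((eta * mean_label H h (z i))%:E * f i true
    + (eta * (1 - mean_label H h (z i)))%:E * f i false))%E.
  congr (_ * (_ + _))%E.
  - rewrite -integral_label_prob.
    exact: (ge0_integralZr lebesgue_measure mD mp p0 (f0 i true)).
  - rewrite -integral_label_probC.
    exact: (ge0_integralZr lebesgue_measure mD mpC pC0 (f0 i false)).
rewrite subr0.
have q0 : 0 <= eta * mean_label H h (z i).
  by rewrite -lee_fin -integral_label_prob; apply: integral_ge0 => t; exact: p0.
have q1 : 0 <= eta * (1 - mean_label H h (z i)).
  by rewrite -lee_fin -integral_label_probC; apply: integral_ge0 => t; exact: pC0.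
rewrite ge0_muleDr ?mule_ge0 ?lee_fin// !muleA -!EFinM !mulrA !mulVf ?gt_eqF//.
by rewrite !mul1r.
Qed.

Lemma mean_label01 H h z :
    (forall t, 0 <= t <= eta -> 0 <= lp H h z t <= 1) ->
  0 <= mean_label H h z <= 1.
Proof.
move=> lp01; apply/andP; split.
  rewrite -(pmulr_rge0 _ eta_gt0) -lee_fin -integral_label_prob.
  by apply: integral_ge0 => t; rewrite /= in_itv/= => /lp01/andP[? _]; rewrite lee_fin.
rewrite -subr_ge0 -(pmulr_rge0 _ eta_gt0) -lee_fin -integral_label_probC.
by apply: integral_ge0 => t; rewrite /= in_itv/= => /lp01/andP[_ ?]; rewrite lee_fin subr_ge0.
Qed.


End integrated_label.

Section resample.
Context {R : realType} d {X : measurableType d}.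
Variables (eta : R) (eta_gt0 : 0 < eta) (sigma : R) (S : nat).
Hypotheses (sigma01 : 0 <= sigma <= 1) (S_gt0 : (0 < S)%N).
Local Notation data := (S.-tuple (X * bool)%type).
Local Notation hist_t := (@history R d X S).
Local Notation phi := (@potential R).
Implicit Types (Dt : data) (hist : hist_t) (F : X * bool -> R).

(* [resample] is finitely supported: these are its weighted atoms. *)
Fixpoint atoms Dt hist : seq (R * (X * bool)) :=
  if hist is (Dp, hp) :: hist' then
    [seq ((1 - sigma) * a.1, a.2) | a <- atoms Dp hist'] ++
    ([seq (sigma * (S%:R^-1 * mean_label eta sigma (ensemble eta hist') hp z),
           (z.1, true)) | z <- Dt] ++
     [seq (sigma * (S%:R^-1 * (1 - mean_label eta sigma (ensemble eta hist') hp z)),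
           (z.1, false)) | z <- Dt])
  else [seq (S%:R^-1, z) | z <- Dt].

Definition atom_mean Dt hist F : R := \sum_(a <- atoms Dt hist) a.1 * F a.2.

Lemma atom_mean_nil Dt F :
  atom_mean Dt [::] F = S%:R^-1 * \sum_(i < S) F (tnth Dt i).
Proof. by rewrite /atom_mean/= big_map/= big_tuple mulr_sumr. Qed.

Lemma atom_mean_cons Dt Dp hp hist F :
  atom_mean Dt ((Dp, hp) :: hist) F =
    (1 - sigma) * atom_mean Dp hist F +
    sigma * (S%:R^-1 * \sum_(i < S)
      (let z := tnth Dt i in let q := mean_label eta sigma (ensemble eta hist) hp z in
       q * F (z.1, true) + (1 - q) * F (z.1, false))).
Proof.
rewrite /atom_mean/= !big_cat/= !big_map/=; congr (_ + _).
  by rewrite mulr_sumr; apply: eq_bigr => a _; rewrite mulrA.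
rewrite -big_split/= big_tuple !mulr_sumr; apply: eq_bigr => z _.
by rewrite /=; ring.
Qed.

Lemma well_posed_label Dt h Dp hp hist :
  well_posed eta sigma phi ((Dt, h) :: (Dp, hp) :: hist) ->
  (forall z, z \in (Dt : seq _) -> forall t, 0 <= t <= eta ->
     0 <= label_prob eta sigma phi (ensemble eta hist) hp z t <= 1) /\
  well_posed eta sigma phi ((Dp, hp) :: hist).
Proof. by move=> [wp1 wp]; split => // z /tnthP[i ->] t t0; exact: wp1. Qed.

Lemma atoms_ge0 Dt h hist : well_posed eta sigma phi ((Dt, h) :: hist) ->
  all (fun a => 0 <= a.1) (atoms Dt hist).
Proof.
have /andP[s0 s1] := sigma01.
elim: hist Dt h => [|[Dp hp] hist IH] Dt h.
  by move=> _; rewrite all_map; apply/allP => z _ /=; rewrite invr_ge0.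
move=> /well_posed_label[wp1 wp]; rewrite /= !all_cat !all_map.
have q01 z : z \in (Dt : seq _) ->
    0 <= mean_label eta sigma (ensemble eta hist) hp z <= 1.
  by move=> zD; apply: (mean_label01 eta_gt0); exact: wp1.
apply/and3P; split.
- apply: sub_all (IH _ _ wp) => a /= a0.
  by rewrite mulr_ge0// subr_ge0.
- apply/allP => z /q01/andP[q0 _] /=.
  by rewrite !mulr_ge0// invr_ge0.
- apply/allP => z /q01/andP[_ q1] /=.
  by rewrite !mulr_ge0 ?invr_ge0// subr_ge0.
Qed.

Lemma atoms_sum1 Dt hist : \sum_(a <- atoms Dt hist) a.1 = 1.
Proof.
transitivity (atom_mean Dt hist (fun=> 1)).
  by rewrite /atom_mean; under [RHS]eq_bigr do rewrite mulr1.
have S1 : S%:R^-1 * \sum_(i < S) 1 = 1 :> R.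
  by rewrite sumr_const card_ord mulVf// pnatr_eq0 -lt0n.
elim: hist Dt => [|[Dp hp] hist IH] Dt; first by rewrite atom_mean_nil S1.
rewrite atom_mean_cons IH mulr1.
under eq_bigr do rewrite /= !mulr1 addrC subrK.
by rewrite S1 mulr1 subrK.
Qed.

Lemma monotone_relabel Dt (H h : X -> R) : monotone_law
  (bind (draw (uniform_prob eta_gt0)) (fun eta' =>
   bind (draw_uniform Dt) (fun z =>
   bind (draw (bernoulli_prob (label_prob eta sigma phi H h z eta')))
     (fun yhat : bool => ret (z.1, yhat))))).
Proof.
apply: monotone_bind => [|t]; first exact: monotone_draw.
apply: monotone_bind => [|z]; first exact: monotone_draw_uniform.
apply: monotone_bind => [|b]; [exact: monotone_draw|exact: monotone_ret].
Qed.

Lemma monotone_resample Dt hist : monotone_law (resample eta_gt0 sigma phi Dt hist).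
Proof.
elim: hist Dt => [|[Dp hp] hist IH] Dt /=; first exact: monotone_draw_uniform.
apply: monotone_bind => [|[]]; [exact: monotone_draw|exact: monotone_relabel|exact: IH].
Qed.

(** The only continuous randomness is [eta']. It enters through the label probability alone, and its
    average there is [mean_label]; well-posedness keeps these probabilities in [0, 1], so that no
    default value intervenes. *)
Lemma resample_atomic Dt h hist : well_posed eta sigma phi ((Dt, h) :: hist) ->
  forall f : X * bool -> \bar R, (forall z, 0 <= f z)%E ->
  resample eta_gt0 sigma phi Dt hist f = atomic_law (atoms Dt hist) f.
Proof.
have /andP[s0 s1] := sigma01.
elim: hist Dt h => [|[Dp hp] hist IH] Dt h.
  by move=> _ f f0; rewrite /= /atomic_law /= big_map/= big_tuple.
move=> wp f f0; have /well_posed_label[wp1 wp'] := wp.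
rewrite /= /bind draw_bernoulli/=; last first.
  case.
    exact: (law_ge0 (monotone_relabel Dt (ensemble eta hist) hp)).
  exact: (law_ge0 (monotone_resample Dp hist)).
rewrite /unit_or0 sigma01 (IH _ _ wp')// addeC.
rewrite /atomic_law /= !big_cat/= !big_map/=; congr (_ + _)%E.
  rewrite big_seq ge0_sume_distrr; last first.
    by move=> a al; rewrite mule_ge0// lee_fin; exact: (allP (atoms_ge0 wp')).
  by rewrite [RHS]big_seq; apply: eq_bigr => a _; rewrite EFinM muleA.
have -> : (fun eta' => draw_uniform Dt (fun z => draw (bernoulli_prob
     (label_prob eta sigma phi (ensemble eta hist) hp z eta'))
     (fun yhat => ret (z.1, yhat) f))) = (fun t => \sum_(i < S) (S%:R^-1)%:E * draw
     (bernoulli_prob (label_prob eta sigma phi (ensemble eta hist) hp (tnth Dt i) t))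
     (fun b => f ((tnth Dt i).1, b)))%E by [].
have wpi i t : 0 <= t <= eta ->
    0 <= label_prob eta sigma phi (ensemble eta hist) hp (tnth Dt i) t <= 1.
  by move=> t0; apply: wp1 => //; exact: mem_tnth.
have q01 i := mean_label01 eta_gt0 (wpi i).
rewrite draw_uniform_label ?invr_ge0// ge0_sume_distrr; last first.
  move=> i _; have /andP[q0 q1] := q01 i.
  by rewrite mule_ge0 ?lee_fin ?invr_ge0// adde_ge0// mule_ge0// lee_fin// subr_ge0.
rewrite -big_split/= big_tuple; apply: eq_bigr => i _.
have /andP[q0 q1] := q01 i.
rewrite ge0_muleDr; [|by rewrite mule_ge0|by rewrite mule_ge0// lee_fin subr_ge0].
rewrite ge0_muleDr; first by rewrite !EFinM !muleA.
- by rewrite !mule_ge0// lee_fin invr_ge0.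
- by rewrite !mule_ge0// lee_fin ?subr_ge0// invr_ge0.
Qed.


End resample.

(** * Correlations and the derivative of the population potential *)

Section correlation.
Context {R : realType} d {X : measurableType d}.
Implicit Types (P D : probability (X * bool)%type R) (h : X -> bool) (v H : X -> R).

Lemma bmf_pm_snd : bmf (fun z : X * bool => pm z.2 : R).
Proof.
split; last by exists 1 => z; rewrite normr_pm.
have -> : (fun z : X * bool => pm z.2 : R) = (pm \o snd) by [].
apply: measurableT_comp; last exact: measurable_snd.
by apply: measurable_fun_ifT => //; exact: measurable_cst.
Qed.

Lemma bmf_fst v : bmf v -> bmf (fun z : X * bool => v z.1).
Proof.
move=> [mv [M vM]]; split; last by exists M => z.
exact: measurableT_comp mv measurable_fst.
Qed.

Lemma bmf_pm h : measurable_fun setT h -> bmf (fun x => pm (h x) : R).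
Proof.
move=> mh; split; last by exists 1 => z; rewrite normr_pm.
by apply: measurable_fun_ifT => //; exact: measurable_cst.
Qed.

Definition agreement h (z : X * bool) : R := pm z.2 * pm (h z.1).

Lemma bmf_agreement h : measurable_fun setT h -> bmf (agreement h).
Proof.
by move=> mh; apply: bmfM; [exact: bmf_pm_snd|exact: bmf_fst (bmf_pm mh)].
Qed.

Lemma normr_agreement h z : `|agreement h z| = 1.
Proof. by rewrite normrM !normr_pm mulr1. Qed.

Lemma corrE P h : corr P h = Ex P (agreement h).
Proof. by rewrite /corr unlock. Qed.

(** Valid for non-measurable [h] as well: the integral is the difference of the lower integrals of
    the positive and negative parts, and both lie in [0, 1]. *)
Lemma normr_corr_le1 P h : `|corr P h| <= 1.
Proof.
pose f (z : X * bool) : \bar R := (agreement h z)%:E.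
rewrite corrE /Ex /Rintegral (integralE _ _ f).
have part (g : X * bool -> \bar R) : (forall z, 0 <= g z <= 1)%E ->
    exists2 a : R, (\int[P]_z g z = a%:E)%E & 0 <= a <= 1.
  move=> g01; have i0 : (0 <= \int[P]_z g z)%E.
    by apply: integral_ge0 => z _; case/andP: (g01 z).
  have i1 : (\int[P]_z g z <= 1)%E.
    rewrite -(law_cst1 (monotone_draw P)); apply: (law_le (monotone_draw P)) => z;
      by case/andP: (g01 z).
  move: i0 i1; case: (\int[P]_z g z)%E => [a|//|//]; rewrite !lee_fin => a0 a1.
  by exists a; rewrite // a0 a1.
have fb z : (f z = 1%E \/ f z = (- 1)%:E).
  have [E|E] : pm z.2 * pm (h z.1) = 1 :> R \/ pm z.2 * pm (h z.1) = -1 :> R.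
    by case: z.2; case: (h z.1); rewrite /pm ?mulrNN ?mul1r ?mulr1;
      [left|right|right|left].
  - by left; rewrite /f /agreement E.
  - by right; rewrite /f /agreement E.
have [a -> /andP[a0 a1]] : exists2 a : R, (\int[P]_z f^\+ z = a%:E)%E & 0 <= a <= 1.
  apply: part => z; rewrite funepos_ge0/=.
  by rewrite funeposE ge_max; case: (fb z) => ->; rewrite !lee_fin; lra.
have [b -> /andP[b0 b1]] : exists2 a : R, (\int[P]_z f^\- z = a%:E)%E & 0 <= a <= 1.
  apply: part => z; rewrite funeneg_ge0/=.
  by rewrite funenegE ge_max; case: (fb z) => ->; rewrite -EFinN !lee_fin; lra.
by rewrite /= ler_norml; lra.
Qed.

Section max_corr.
Variable HH : set (X -> bool).

Lemma le_max_corr P h : HH h -> corr P h <= max_corr P HH.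
Proof.
move=> Hh; apply: ub_le_sup; last by exists h.
by exists 1 => _ [g Hg <-]; exact: le_trans (ler_norm _) (normr_corr_le1 P g).
Qed.

Lemma max_corr_adherent P (e : R) : HH !=set0 -> 0 < e ->
  exists2 h, HH h & max_corr P HH - e < corr P h.
Proof.
move=> [h0 Hh0] e0.
have [|_ [h Hh <-] hE] := @sup_adherent _ [set corr P h | h in HH] _ e0.
  split; first by exists (corr P h0), h0.
  by exists 1 => _ [g Hg <-]; exact: le_trans (ler_norm _) (normr_corr_le1 P g).
by exists h.
Qed.

Lemma max_corr_le1 P : HH !=set0 -> max_corr P HH <= 1.
Proof.
move=> [h0 Hh0]; apply: ge_sup; first by exists (corr P h0), h0.
by move=> _ [g Hg <-]; exact: le_trans (ler_norm _) (normr_corr_le1 P g).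
Qed.

End max_corr.

Definition margin H (z : X * bool) : R := pm z.2 * H z.1.

Lemma bmf_margin H : bmf H -> bmf (margin H).
Proof. by move=> bH; apply: bmfM; [exact: bmf_pm_snd|exact: bmf_fst]. Qed.

Lemma bmf_dpotential_margin H : bmf H -> bmf (fun z => dpotential (margin H z)).
Proof.
move=> bH; apply: bmf_comp (bmf_margin bH) _; first exact: continuous_dpotential.
move=> M; exists 1 => x _; have := dpotential_bound x.
by rewrite ler_norml; lra.
Qed.

Lemma normr_dpotential (x : R) : `|dpotential x| <= 1.
Proof. by have := dpotential_bound x; rewrite ler_norml; lra. Qed.

(* [descent D H v] is minus the derivative at [H], in the direction [v], of the
   population potential. *)
Definition descent D H v : R :=
  - Ex D (fun z => margin v z * dpotential (margin H z)).

Lemma bmf_descent H v : bmf H -> bmf v ->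
  bmf (fun z => margin v z * dpotential (margin H z)).
Proof. by move=> bH bv; apply: bmfM; [exact: bmf_margin|exact: bmf_dpotential_margin]. Qed.

Lemma descentZ D H v (c : R) : bmf H -> bmf v ->
  descent D H (fun x => c * v x) = c * descent D H v.
Proof.
move=> bH bv; rewrite /descent mulrN -ExZ; last exact: bmf_descent.
by congr (- Ex D _); apply/funext => z; rewrite /margin; ring.
Qed.

Lemma bmf_sign_pm H : bmf H -> bmf (fun x => pm (sign H x) : R).
Proof.
move=> [mH _]; apply: bmf_pm; rewrite /sign.
by apply: measurable_fun_ler => //; exact: measurable_cst.
Qed.

(* At a point where [sign H] errs, the weight [- dpotential] is 1; elsewhere it
   is at most 1 and multiplies a nonpositive quantity. *)
Lemma corr_gap_le D H h : bmf H -> measurable_fun setT h ->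
  corr D h - corr D (sign H) <=
    descent D H (fun x => pm (h x)) + descent D H (fun x => - pm (sign H x)).
Proof.
move=> bH mh; have ms : measurable_fun setT (sign H).
  by rewrite /sign; case: bH => mH _; apply: measurable_fun_ler => //; exact: measurable_cst.
have bh := bmf_pm mh; have bs := bmf_sign_pm bH.
rewrite !corrE -ExB; try exact: bmf_agreement.
rewrite /descent -opprD -ExD; try (exact: bmf_descent || exact: bmf_descent (bmfN _)).
rewrite -ExN; last by apply: bmfD; apply: bmf_descent => //; exact: bmfN.
apply: le_Ex.
- by apply: bmfB; exact: bmf_agreement.
- by apply: bmfN; apply: bmfD; apply: bmf_descent => //; exact: bmfN.
move=> [x b]; rewrite /agreement /margin /=.
have := dpotential_bound (pm b * H x); have := @dpotential_le0 R (pm b * H x).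
rewrite /sign; case: b; case: (h x); case: (lerP 0 (H x)) => Hx; rewrite /pm ?mul1r ?mulN1r ?mulrN1 ?mulr1 => W0 W;
  by [nra|rewrite W0; lra].
Qed.

End correlation.

(** * Exponential moments of the noise *)

Section noise.
Context {R : realType} d {X : measurableType d}.
Variables (D : probability (X * bool)%type R) (eta gamma sigma : R) (S : nat).
Hypotheses (eta_gt0 : 0 < eta) (gamma_gt0 : 0 < gamma) (sigmaE : sigma = eta / gamma)
  (sigma_le1 : sigma <= 1) (S_gt0 : (0 < S)%N).
Local Notation data := (S.-tuple (X * bool)%type).
Local Notation hist_t := (@history R d X S).
Implicit Types (Dt : data) (hist : hist_t) (h : X -> bool) (v H : X -> R).

Lemma sigma_gt0 : 0 < sigma. Proof. by rewrite sigmaE divr_gt0. Qed.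

Let s0 := sigma_gt0.

Let es0 : 0 < eta + sigma. Proof. exact: addr_gt0. Qed.

Fixpoint regular hist : Prop :=
  if hist is r :: hist' then
    (bmf r.2 /\ forall x, `|r.2 x| <= gamma^-1) /\ regular hist'
  else True.

Lemma bmf_ensemble hist : regular hist -> bmf (ensemble eta hist).
Proof.
elim: hist => [_|[Dt v] hist IH [[/= bv _] /IH bH]]; first exact: bmf_cst.
by apply: bmfD => //; exact: bmfZ.
Qed.

Definition noise Dt hist h : R :=
  atom_mean eta sigma Dt hist (agreement h) -
  sigma / (eta + sigma) * descent D (ensemble eta hist) (fun x => pm (h x)).

(** The mean agreement of [h] with the regenerated label of the sample [z], that is [pm (h z.1)]
    times 2 q - 1 with q the [mean_label]. *)
Definition increment H v h (z : X * bool) : R :=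
  - (agreement h z * (dpotential (margin (fun x => H x + eta * v x) z)
                      - (1 - sigma) * dpotential (margin H z))) / (eta + sigma).

Lemma bmf_increment H v h : bmf H -> bmf v -> measurable_fun setT h ->
  bmf (increment H v h).
Proof.
move=> bH bv mh.
have -> : increment H v h = (fun z => (- (eta + sigma)^-1) * (agreement h z *
    (dpotential (margin (fun x => H x + eta * v x) z) -
      (1 - sigma) * dpotential (margin H z)))).
  by apply/funext => z; rewrite /increment; ring.
apply: bmfZ; apply: bmfM; first exact: bmf_agreement.
apply: bmfB; last by apply: bmfZ; exact: bmf_dpotential_margin.
by apply: bmf_dpotential_margin; apply: bmfD => //; exact: bmfZ.
Qed.

(** The small denominator does no harm. With a and b the new and old derivatives, a - (1 - sigma) b
    = (a - b) + sigma b; the Lipschitz bound makes the first term at most eta / gamma = sigma, and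
    the second is at most sigma. *)
Lemma increment_bound H v h z : (forall x, `|v x| <= gamma^-1) ->
  `|increment H v h z| <= 2.
Proof.
move=> vb; rewrite /increment normrM normrN normrM normr_agreement mul1r.
rewrite [X in _ * X]gtr0_norm ?invr_gt0// ler_pdivrMr//.
have -> : forall a b : R, a - (1 - sigma) * b = (a - b) + sigma * b.
  by move=> a b; ring.
apply: le_trans (ler_normD _ _) _.
apply: (@le_trans _ _ (sigma + sigma)); last by have := eta_gt0; lra.
apply: lerD; last by rewrite normrM (gtr0_norm s0) ler_piMr ?normr_dpotential ?ltW.
apply: le_trans (dpotential_lip _ _) _.
have -> : margin (fun x => H x + eta * v x) z - margin H z = pm z.2 * (eta * v z.1).
  by rewrite /margin; ring.
by rewrite normrM normr_pm mul1r normrM (gtr0_norm eta_gt0) sigmaE ler_wpM2l// ltW.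
Qed.

(** The mean increment is exactly the change of the ideal correlation in the recursion with factor 1
    - sigma; therefore the noise recursion [noise_cons] is centred. *)
Lemma Ex_increment H v h : bmf H -> bmf v -> measurable_fun setT h ->
  sigma * Ex D (increment H v h) =
  sigma / (eta + sigma) * (descent D (fun x => H x + eta * v x) (fun x => pm (h x))
    - (1 - sigma) * descent D H (fun x => pm (h x))).
Proof.
move=> bH bv mh.
have bHv : bmf (fun x => H x + eta * v x) by apply: bmfD => //; exact: bmfZ.
have bh := bmf_pm mh.
have -> : increment H v h = (fun z => (- (eta + sigma)^-1) *
   (margin (fun x => pm (h x)) z * dpotential (margin (fun x => H x + eta * v x) z)
    + (- (1 - sigma)) * (margin (fun x => pm (h x)) z * dpotential (margin H z)))).
  by apply/funext => z; rewrite /increment /agreement /margin; ring.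
rewrite ExZ; last first.
  by apply: bmfD; [exact: bmf_descent|apply: bmfZ; exact: bmf_descent].
rewrite ExD; [|exact: bmf_descent|by apply: bmfZ; exact: bmf_descent].
rewrite ExZ; last exact: bmf_descent.
rewrite /descent; move: (Ex D (fun z => _ * dpotential (margin H z))) => A.
by move: (Ex D _) => B; ring.
Qed.

Lemma noise_nil_bound Dt h : measurable_fun setT h -> `|noise Dt [::] h| <= 2.
Proof.
move=> mh; apply: le_trans (ler_normB _ _) _; apply: (@lerD _ _ 1 _ 1).
  rewrite atom_mean_nil normrM ger0_norm ?invr_ge0// mulrC ler_pdivrMr ?ltr0n// mul1r.
  apply: le_trans (ler_norm_sum _ _ _) _.
  by under eq_bigr do rewrite normr_agreement; rewrite sumr_const card_ord.
rewrite normrM -[leRHS]mulr1 ler_pM//.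
  rewrite normrM gtr0_norm// [X in _ * X]gtr0_norm ?invr_gt0// ler_pdivrMr// mul1r.
  by rewrite lerDr ltW.
rewrite /descent normrN; apply: Ex_bound.
  by apply: bmf_descent; [exact: bmf_cst|exact: bmf_pm].
by move=> z; rewrite !normrM !normr_pm !mul1r normr_dpotential.
Qed.

Lemma noise_cons Dt Dp v hist h : regular ((Dp, v) :: hist) -> measurable_fun setT h ->
  noise Dt ((Dp, v) :: hist) h = (1 - sigma) * noise Dp hist h +
   sigma / S%:R * \sum_(i < S) (increment (ensemble eta hist) v h (tnth Dt i)
     - Ex D (increment (ensemble eta hist) v h)).
Proof.
move=> [[bv vb] /bmf_ensemble bH] mh.
rewrite /noise atom_mean_cons sumrB sumr_const card_ord.
rewrite (eq_bigr (fun i => increment (ensemble eta hist) v h (tnth Dt i))); last first.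
  move=> i _; rewrite /increment /agreement /mean_label /margin /=.
  by field; rewrite gt_eqF.
set E := Ex D _; set s := \sum_(i < S) _.
have := Ex_increment bH bv mh; rewrite -/E /= => EE.
rewrite -[E *+ S]mulr_natr.
have -> : sigma / S%:R * (s - E * S%:R) = sigma * (S%:R^-1 * s) - sigma * E.
  by field; rewrite pnatr_eq0 -lt0n.
rewrite EE.
move: (descent D (fun x => ensemble eta hist x + eta * v x) _) => A.
by move: (descent D _ _) (atom_mean _ _ _ _ _) (sigma / _) => *; ring.
Qed.

Section exponential_moments.
Variables (lam theta V : R).
Hypotheses (lam_ge0 : 0 <= lam) (lam_small : 8 * lam * sigma <= S%:R)
  (VE : V = 32 * lam ^+ 2 * sigma / S%:R).

(** The first term is the a priori bound on the noise of the first round after [k] contractions;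
    [theta] is the fluctuation granted to the later samples. *)
Definition threshold (k : nat) : R := 2 * (1 - sigma) ^+ k + theta.

(* The conditional mean of the signed noise of the next round; 2 is an a priori
   bound for the first round, whose sample is not averaged with older ones. *)
Definition predicted_noise hist h (b : bool) : R :=
  if hist is (Dp, _) :: hist' then (1 - sigma) * (pm b * noise Dp hist' h) else 2.

(* Exponential bounds on the noise [j] rounds ahead, before and after the
   sample of the current round is drawn. *)
Definition tail_before hist h b j : R :=
  expR (lam * (1 - sigma) ^+ j * predicted_noise hist h b
        + V * (1 - (1 - sigma) ^+ j.+1) - lam * threshold (size hist + j)).

Definition tail_after Dt hist h b j : R :=
  expR (lam * (1 - sigma) ^+ j * (pm b * noise Dt hist h)
        + V * (1 - (1 - sigma) ^+ j) - lam * threshold (size hist + j)).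

Lemma tail_afterS Dt v hist h b j :
  tail_after Dt hist h b j.+1 = tail_before ((Dt, v) :: hist) h b j.
Proof.
rewrite /tail_after /tail_before /=; congr expR; rewrite addnS addSn.
by congr (_ + _ - _); rewrite exprSr; ring.
Qed.

Lemma tail_after0 Dt hist h b : threshold (size hist) < pm b * noise Dt hist h ->
  1 <= tail_after Dt hist h b 0.
Proof.
move=> lt; rewrite /tail_after expr0 mulr1 subrr mulr0 addr0 addn0 -mulrBr.
by rewrite -[leLHS]expR0 ler_expR mulr_ge0// subr_ge0 ltW.
Qed.

(** A supermartingale step. The noise is affine in a sum over the fresh sample, so its exponential
    is a product over that sample, the form required by [iid_lower_bound]. The difference between
    the [V] terms of [tail_before] and [tail_after] pays for the moment generating functions. *)
Lemma tail_expectation hist h b j : regular hist -> measurable_fun setT h ->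
  exists c : R, exists g : X * bool -> R,
    [/\ 0 <= c, bmf g,
        forall Dt, tail_after Dt hist h b j <= c * \prod_(i < S) g (tnth Dt i)
      & c * Ex D g ^+ S <= tail_before hist h b j].
Proof.
have q0 : 0 <= 1 - sigma by rewrite subr_ge0.
have q1 : 1 - sigma <= 1 by have := s0; lra.
have V0 : 0 <= V by rewrite VE divr_ge0// mulr_ge0 ?(ltW s0)// mulr_ge0// exprn_ge0.
move=> rh mh; case: hist rh => [_|[Dp v] hist rh].
  (* In the first round the noise is simply bounded by 2, and nothing is averaged. *)
  exists (tail_before [::] h b j), (fun=> 1); split.
  - exact: expR_ge0.
  - exact: bmf_cst.
  - move=> Dt; rewrite big1// mulr1 /tail_before /tail_after ler_expR lerD2r lerD//.
      rewrite ler_wpM2l ?mulr_ge0 ?exprn_ge0//= (le_trans (ler_norm _))//.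
      by rewrite normrM normr_pm mul1r noise_nil_bound.
    by rewrite ler_wpM2l// lerD2l lerN2 exprS ler_piMl ?exprn_ge0.
  - by rewrite Ex_cst expr1n mulr1.
have [[/= bv vb] /bmf_ensemble bH] := rh.
pose xi := increment (ensemble eta hist) v h.
have bxi : bmf xi by exact: bmf_increment.
pose k := lam * (1 - sigma) ^+ j * pm b * (sigma / S%:R).
pose u z := k * xi z.
have bu : bmf u by exact: bmfZ.
have Eu : Ex D u = k * Ex D xi by rewrite ExZ.
pose q := lam * (1 - sigma) ^+ j.
have q0' : 0 <= q by rewrite mulr_ge0 ?exprn_ge0.
have kb : `|k| = q * sigma / S%:R.
  rewrite /k normrM normrM normr_pm mulr1 -/q (ger0_norm q0') normrM (gtr0_norm s0).
  by rewrite normfV normr_nat mulrA.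
pose w := q * sigma / S%:R.
have w0 : 0 <= w by rewrite /w -kb.
have ub z : `|u z| <= 2 * w.
  by rewrite /u normrM kb mulrC ler_wpM2r// increment_bound.
(* The bound [lam_small] puts the exponent in the range where [mgf_bound] applies. *)
have w4 : 2 * w <= 4^-1.
  have S0 : 0 < S%:R :> R by rewrite ltr0n.
  have : w <= lam * sigma / S%:R.
    rewrite ler_wpM2r ?invr_ge0// ler_wpM2r ?(ltW s0)//.
    by rewrite /q ler_piMr// exprn_ile1.
  have : lam * sigma / S%:R <= 8^-1.
    by rewrite ler_pdivrMr//; have := lam_small; rewrite -mulrA; set k8 := lam * sigma; lra.
  lra.
exists (expR (lam * (1 - sigma) ^+ j * ((1 - sigma) * (pm b * noise Dp hist h))
   + V * (1 - (1 - sigma) ^+ j) - lam * threshold (size ((Dp, v) :: hist) + j))).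
exists (fun z => expR (u z - Ex D u)); split.
- exact: expR_ge0.
- by apply: bmf_expR; apply: bmfB => //; exact: bmf_cst.
- move=> Dt; rewrite -expR_sum -expRD ler_expR /tail_after noise_cons//.
  rewrite le_eqVlt; apply/orP; left; apply/eqP.
  have -> : \sum_(i < S) (u (tnth Dt i) - Ex D u) =
      k * \sum_(i < S) (xi (tnth Dt i) - Ex D xi).
    by rewrite mulr_sumr; apply: eq_bigr => i _; rewrite Eu mulrBr.
  by rewrite /k -/xi; ring.
- apply: (@le_trans _ _ (expR (lam * (1 - sigma) ^+ j * ((1 - sigma) * (pm b * noise Dp hist h))
   + V * (1 - (1 - sigma) ^+ j) - lam * threshold (size ((Dp, v) :: hist) + j))
   * expR (8 * (2 * w) ^+ 2) ^+ S)).
    rewrite ler_wpM2l ?expR_ge0// lerXn2r ?nnegrE ?expR_ge0//.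
      by apply: Ex_ge0 => z; exact: expR_ge0.
    exact: mgf_bound.
  rewrite -expRM_natl -expRD ler_expR /tail_before /=.
  (* The cost carries (1 - sigma)^(2j). One of the two factors is dropped, so that the costs form a
     geometric series with sum at most [V]. *)
  have key : S%:R * (8 * (2 * w) ^+ 2) <= V * (sigma * (1 - sigma) ^+ j).
    rewrite VE /w /q; set a := (1 - sigma) ^+ j.
    have -> : S%:R * (8 * (2 * (lam * a * sigma / S%:R)) ^+ 2) =
        32 * lam ^+ 2 * sigma / S%:R * (sigma * a) * a.
      by field; rewrite pnatr_eq0 -lt0n.
    by rewrite ler_piMr ?exprn_ile1// -VE !mulr_ge0 ?exprn_ge0// ltW.
  have E : V * (1 - (1 - sigma) ^+ j.+1) =
      V * (1 - (1 - sigma) ^+ j) + V * (sigma * (1 - sigma) ^+ j).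
    by rewrite exprS; ring.
  by rewrite E; lra.
Qed.

End exponential_moments.
End noise.

(** * One call of the weak learner *)

Section exponential_tilting.
Context {R : realType} d {X : measurableType d}.
Variables (P : probability (X * bool)%type R) (h : X -> bool).
Hypothesis mh : measurable_fun setT h.

Definition tilt (k : R) (z : X * bool) : R :=
  expR (k * agreement h z - Ex P (fun z => k * agreement h z)).

Lemma tilt_ge0 k z : 0 <= tilt k z. Proof. exact: expR_ge0. Qed.

Lemma bmf_tilt k : bmf (tilt k).
Proof.
apply: bmf_expR; apply: bmfB; last exact: bmf_cst.
by apply: bmfZ; exact: bmf_agreement.
Qed.

Variables (n : nat) (theta : R).
Hypotheses (n_gt0 : (0 < n)%N) (theta04 : 0 < theta <= 4).

(** The minimizer of 8 kappa^2 - kappa theta; it yields the exponent - theta^2 / 32 per sample. The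
    bound theta <= 4 ensures kappa <= 1/4. *)
Let kappa := theta / 16.

Let kappa_ge0 : 0 <= kappa.
Proof. by rewrite /kappa divr_ge0// ltW//; case/andP: theta04. Qed.

Definition tail_weight : R := expR (- (theta / 16 * n%:R * theta)).

Lemma Ex_tilt_le (b : bool) :
  tail_weight * Ex P (tilt (theta / 16 * pm b)) ^+ n <=
  expR (- (n%:R * theta ^+ 2 / 32)).
Proof.
have ub z : `|kappa * pm b * agreement h z| <= kappa.
  by rewrite normrM normr_agreement normrM normr_pm !mulr1 ger0_norm.
have k4 : kappa <= 4^-1 by have /andP[_ t4] := theta04; rewrite /kappa; lra.
have bu : bmf (fun z => kappa * pm b * agreement h z) by apply: bmfZ; exact: bmf_agreement.
apply: (@le_trans _ _ (tail_weight * expR (8 * kappa ^+ 2) ^+ n)).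
  rewrite ler_wpM2l ?expR_ge0// lerXn2r ?nnegrE ?expR_ge0//.
    by apply: Ex_ge0 => z; exact: expR_ge0.
  exact: mgf_bound.
rewrite -expRM_natl -expRD ler_expR le_eqVlt; apply/orP; left; apply/eqP.
by rewrite /kappa; field.
Qed.

(** A Chernoff bound before integration: a two-sided deviation is dominated by two exponentials, one
    for each sign, that are products over the sample. *)
Lemma deviation_le_tilt (s : n.-tuple (X * bool)%type) :
  theta < `|emp_corr s h - corr P h| ->
  1 <= \sum_(b : bool) tail_weight * \prod_(i < n) tilt (theta / 16 * pm b) (tnth s i).
Proof.
have eE (b : bool) : tail_weight * \prod_(i < n) tilt (theta / 16 * pm b) (tnth s i) =
    expR (kappa * n%:R * (pm b * (emp_corr s h - corr P h) - theta)).
  rewrite -expR_sum -expRD; congr expR; rewrite ExZ; last exact: bmf_agreement.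
  rewrite -corrE sumrB -mulr_sumr sumr_const card_ord -mulr_natr /emp_corr /emp_sum.
  rewrite /agreement /kappa; move: (corr P _) (\sum_(i < n) _) => c s'.
  by field; rewrite pnatr_eq0 -lt0n.
have k0 : 0 <= kappa * n%:R by exact: mulr_ge0.
move=> dev; have [b bE] : exists b, theta < pm b * (emp_corr s h - corr P h).
  move: dev; rewrite lter_normr => /orP[] dev; [exists true|exists false].
    by rewrite mul1r.
  by rewrite mulN1r.
rewrite (eq_bigr _ (fun c _ => eE c)) (bigD1 b)//= -[leLHS]addr0 lerD//.
  by rewrite -[leLHS]expR0 ler_expR mulr_ge0// subr_ge0 ltW.
by apply: sumr_ge0 => c _; exact: expR_ge0.
Qed.

End exponential_tilting.

(** * The weak learner's guarantee on resampled data *)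

Section weak_learning_step.
Context {R : realType} d {X : measurableType d} {B : {fset (X -> bool)}}.
Variables (W : learner R B) (m : law R (X * bool)%type).
Variables (l : seq (R * (X * bool))) (P : probability (X * bool)%type R).
Hypothesis mm : monotone_law m.
Hypothesis mE : forall f : X * bool -> \bar R, (forall z, 0 <= f z)%E ->
  m f = atomic_law l f.
Hypothesis l0 : all (fun a => 0 <= a.1) l.
Hypothesis PE : forall f : X * bool -> R, bmf f ->
  Ex P f = \sum_(a <- l) a.1 * f a.2.
Hypothesis Pm : forall f : X * bool -> \bar R, (forall z, 0 <= f z)%E ->
  (draw P f <= atomic_law l f)%E.
Hypothesis mB : forall b : X -> bool, b \in B -> measurable_fun setT b.

Let additive_m : additive_law m.
Proof.
move=> f g f0 g0; rewrite !mE//; last by move=> z; exact: adde_ge0.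
exact: additive_atomic_law.
Qed.

Let mZ (g : X * bool -> R) (a : R) : bmf g -> (forall z, 0 <= g z) -> 0 <= a ->
  m (fun z => (a * g z)%:E) = (a * Ex P g)%:E.
Proof.
move=> bg g0 a0; rewrite mE; last by move=> z; rewrite lee_fin mulr_ge0.
rewrite /atomic_law PE// mulr_sumr -sumEFin; apply: eq_bigr => x _.
by rewrite -EFinM mulrCA.
Qed.

Variables (n : nat) (theta delta delta0 v : R) (good : set B).
Hypotheses (n_gt0 : (0 < n)%N) (theta0 : 0 < theta <= 4).
Hypothesis n_large :
  2 * (#|` B|)%:R * expR (- (n%:R * theta ^+ 2 / 32)) <= delta.
Hypothesis v_le1 : v <= 1.
Hypothesis WL : ((1 - delta0)%:E <=
  Prob (bind (iid n (draw P)) (fun s => draw_pmf (W n s))) good)%E.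

Let e (w : B) (b : bool) (s : n.-tuple (X * bool)%type) : R :=
  tail_weight n theta * \prod_(i < n) tilt P (val w) (theta / 16 * pm b) (tnth s i).

Let mw (w : B) : measurable_fun setT (val w). Proof. by apply: mB; exact: valP. Qed.

Let e_ge0 w b s : 0 <= e w b s.
Proof. by rewrite mulr_ge0 ?expR_ge0// prodr_ge0// => i _; exact: tilt_ge0. Qed.

Let e_mean_le w b : (iid n m (fun s => (e w b s)%:E) <=
  (expR (- (n%:R * theta ^+ 2 / 32)))%:E)%E.
Proof.
rewrite (@iid_prod _ _ n m (tilt P (val w) (theta / 16 * pm b)) _
  (Ex P (tilt P (val w) (theta / 16 * pm b)))).
- by rewrite lee_fin; apply: Ex_tilt_le.
- exact: expR_ge0.
- by move=> z; exact: tilt_ge0.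
- by move=> a a0; rewrite mZ//; [exact: bmf_tilt|move=> z; exact: tilt_ge0].
- by apply: Ex_ge0 => z; exact: tilt_ge0.
Qed.

(** [f] is the value of continuing the run with [w]. A union bound over [B] is taken because [w]
    depends on the sample on which its correlation is estimated. The guarantee holds for [draw P]
    and passes to [m] by [le_iid]; finite support makes [iid n m] additive on arbitrary nonnegative
    functions. *)
Lemma weak_learning_step (f : n.-tuple (X * bool)%type -> B -> \bar R) :
    (forall s w, 0 <= f s w)%E ->
    (forall s w, good w -> `|emp_corr s (val w) - corr P (val w)| <= theta ->
       (v%:E <= f s w)%E) ->
  ((v - delta0 - delta)%:E <= iid n m (fun s => draw_pmf (W n s) (f s)))%E.
Proof.
move=> f0 fv; pose K s : R := \sum_(w : B) \sum_(b : bool) e w b s.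
have K0 s : 0 <= K s by apply: sumr_ge0 => w _; apply: sumr_ge0.
have mW s := monotone_draw_pmf (@learner_ge0 _ _ _ _ W n s) (@learner_sum1 _ _ _ _ W n s).
have v0 : 0 <= 1 - v by rewrite subr_ge0.
(* If [w] is good, either its empirical correlation is accurate and [f] is at least [v], or one of
   the Chernoff terms in [K] already exceeds 1. *)
have cover s w : ((\1_good w)%:E <= f s w + (K s + (1 - v))%:E)%E.
  rewrite indicE; case: (boolP (w \in good)) => [/set_mem gw|_]; last first.
    by rewrite adde_ge0// lee_fin addr_ge0.
  case: (lerP `|emp_corr s (val w) - corr P (val w)| theta) => [small|large].
    apply: (@le_trans _ _ (v%:E + (K s + (1 - v))%:E)%E); last by rewrite leeD2r// fv.
    by rewrite -EFinD lee_fin (_ : v + _ = K s + 1) ?lerDr//; ring.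
  rewrite -[leLHS]add0e leeD// lee_fin ler_wpDr//.
  rewrite /K (bigD1 w)//= -[leLHS]addr0 lerD//; first exact: deviation_le_tilt.
  by apply: sumr_ge0 => ? _; apply: sumr_ge0.
have cover' s : (draw_pmf (W n s) (fun w => (\1_good w)%:E) <=
    draw_pmf (W n s) (f s) + (K s + (1 - v))%:E)%E.
  apply: (@le_trans _ _ (draw_pmf (W n s) (fun w => f s w + (K s + (1 - v))%:E)%E)).
    apply: (law_le (mW s)) => [w|w]; last exact: cover.
    by rewrite lee_fin indicE.
  rewrite /draw_pmf (eq_bigr (fun w => (W n s w)%:E * f s w +
    (W n s w * (K s + (1 - v)))%:E)%E); last first.
    by move=> w _; rewrite ge0_muleDr// lee_fin addr_ge0.
  rewrite big_split/= leeD2l// sumEFin lee_fin.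
  by rewrite -mulr_suml learner_sum1 mul1r.
have mi := monotone_iid n mm; have ai : additive_law (iid n m) by exact: additive_iid.
have ind0 s : (0 <= draw_pmf (W n s) (fun w => (\1_good w)%:E))%E.
  by apply: (law_ge0 (mW s)) => w; rewrite lee_fin indicE.
have F0 s : (0 <= draw_pmf (W n s) (f s))%E by exact: (law_ge0 (mW s)).
have m0 : iid n m (fun=> 0%E) = 0%E.
  rewrite -[RHS](_ : (0 * 1 ^+ n)%:E = 0%E); last by rewrite mul0r.
  rewrite -(@iid_prod _ _ n m (fun=> 1) 0 1)// => [|a a0].
    by congr (iid n m _); apply/funext => s; rewrite mul0r.
  by rewrite mZ ?Ex_cst//; exact: bmf_cst.
have m1 : iid n m (fun=> (1 - v)%:E) = (1 - v)%:E.
  rewrite -[RHS](_ : ((1 - v) * 1 ^+ n)%:E = _); last by rewrite expr1n mulr1.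
  rewrite -(@iid_prod _ _ n m (fun=> 1) (1 - v) 1)// => [|a a0].
    by congr (iid n m _); apply/funext => s; rewrite big1// mulr1.
  by rewrite mZ ?Ex_cst//; exact: bmf_cst.
have mK : (iid n m (fun s => (K s)%:E) <= delta%:E)%E.
  have -> : (fun s => (K s)%:E) = (fun s => \sum_(k : B * bool) (e k.1 k.2 s)%:E)%E.
    by apply/funext => s; rewrite sumEFin /K pair_big.
  rewrite (additive_law_sum _ (f := fun k s => (e k.1 k.2 s)%:E) ai m0); last first.
    by move=> k s; rewrite lee_fin.
  apply: (@le_trans _ _ (\sum_(k : B * bool) (expR (- (n%:R * theta ^+ 2 / 32)))%:E)%E).
    by apply: lee_sum => k _.
  rewrite sumEFin lee_fin sumr_const card_prod card_bool -cardfE -[leLHS]mulr_natl natrM.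
  by rewrite [_%:R * 2%:R]mulrC.
have : ((1 - delta0)%:E <= iid n m (fun s => draw_pmf (W n s) (f s)) +
    (delta%:E + (1 - v)%:E))%E.
  apply: le_trans WL _; rewrite /Prob /bind.
  apply: (@le_trans _ _ (iid n m (fun s => draw_pmf (W n s) (fun w => (\1_good w)%:E)))).
    apply: le_iid => //; first exact: monotone_draw.
    by move=> g g0; rewrite mE// Pm.
  apply: le_trans (law_le mi ind0 cover') _.
  rewrite ai//; last by move=> s; rewrite lee_fin addr_ge0.
  rewrite leeD2l//; under eq_fun do rewrite EFinD.
  by rewrite ai// m1 leeD2r.
rewrite -EFinD -leeBlDr// -EFinB; apply: le_trans.
by rewrite lee_fin; lra.
Qed.

End weak_learning_step.

(** * Descent of the potential *)

Section potential_descent.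
Context {R : realType} d {X : measurableType d}.
Variables (D : probability (X * bool)%type R) (eta gamma sigma : R) (S : nat).
Hypotheses (eta_gt0 : 0 < eta) (gamma01 : 0 < gamma <= 1) (sigmaE : sigma = eta / gamma)
  (sigma_le1 : sigma <= 1).
Local Notation data := (S.-tuple (X * bool)%type).
Local Notation hist_t := (@history R d X S).
Implicit Types (Dt : data) (hist : hist_t) (h : X -> bool) (v H : X -> R).
Variables (hstar : X -> bool) (eps0 tau theta theta' : R).
Hypotheses (eps0_ge0 : 0 <= eps0) (theta_ge0 : 0 <= theta) (theta'_ge0 : 0 <= theta')
  (tau_ge : theta' <= tau).
Hypothesis mhstar : measurable_fun setT hstar.

Let gamma_gt0 : 0 < gamma. Proof. by case/andP: gamma01. Qed.

Let gamma_le1 : gamma <= 1. Proof. by case/andP: gamma01. Qed.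

Let s0 : 0 < sigma. Proof. exact: (sigma_gt0 eta_gt0 gamma_gt0 sigmaE). Qed.

Local Notation thr := (threshold sigma theta).

Lemma threshold_ge0 k : 0 <= thr k.
Proof. by rewrite addr_ge0// mulr_ge0// exprn_ge0// subr_ge0. Qed.

Definition gap H : R := corr D hstar - corr D (sign H).

(* The alternative corresponds to the two branches of [next_hypothesis]. *)
Definition round_ok (k : nat) H v : Prop :=
  [/\ bmf v, forall x, `|v x| <= gamma^-1 &
    (tau - theta' - 2 * thr k) / gamma <= descent D H v \/
    gap H <= 2 * eps0 / gamma + 2 * (tau + theta') / gamma + 2 * thr k / gamma
             + descent D H v].

Let cE : sigma / (eta + sigma) * (1 + gamma) = 1.
Proof.
rewrite sigmaE; field; rewrite gt_eqF//=.
by rewrite gt_eqF// addr_gt0// mulr_gt0.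
Qed.

(** The dichotomy follows the test against [tau]. If the test is passed, [w] truly correlates with
    the resampled data and hence is a descent direction. If not, the weak learner bounds the
    correlation of [hstar] with these data, and [corr_gap_le] turns this into a bound on the gap. *)
Lemma next_round_ok (HH : set (X -> bool)) (P : probability (X * bool)%type R)
    Dt hist m (Dt' : m.-tuple (X * bool)%type) w :
    HH hstar -> measurable_fun setT w ->
    (forall h, measurable_fun setT h ->
       corr P h = atom_mean eta sigma Dt hist (agreement h)) ->
    regular gamma hist ->
    `|noise D eta sigma Dt hist w| <= thr (size hist) ->
    `|noise D eta sigma Dt hist hstar| <= thr (size hist) ->
    gamma * max_corr P HH - eps0 <= corr P w ->
    `|emp_corr Dt' w - corr P w| <= theta' ->
  round_ok (size hist) (ensemble eta hist)
    (next_hypothesis gamma eta tau hist Dt' w).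
Proof.
move=> Hhstar mw PE /bmf_ensemble bH nw nh wl dev.
have bw := bmf_pm mw; have bs := bmf_sign_pm (bH eta).
have t0 := threshold_ge0 (size hist).
(* The definition of [noise] solved for the descent, since sigma / (eta + sigma) = 1 / (1 +
   gamma). *)
have descentE h : measurable_fun setT h ->
    descent D (ensemble eta hist) (fun x => pm (h x)) =
    (1 + gamma) * (corr P h - noise D eta sigma Dt hist h).
  move=> mh; rewrite /noise PE//; move: (descent _ _ _) (atom_mean _ _ _ _ _) => g a.
  by rewrite -[LHS]mul1r -{1}cE; ring.
rewrite /next_hypothesis; case: ltP => [emp|emp].
  split.
  - by under eq_fun do rewrite mulrC; exact: bmfZ.
  - by move=> x; rewrite normrM normr_pm mul1r gtr0_norm// invr_gt0.
  left; rewrite (_ : (fun x => pm (w x) / gamma) = fun x => gamma^-1 * pm (w x)); last first.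
    by apply/funext => x; rewrite mulrC.
  rewrite descentZ// mulrC ler_wpM2l ?invr_ge0 ?(ltW gamma_gt0)// descentE//.
  move: nw dev; rewrite !ler_norml => /andP[n1 n2] /andP[d1 d2].
  move: emp n1 n2 d1 d2; move: (noise _ _ _ _ _ _) (emp_corr _ _) (corr _ _) t0.
  move: (thr _) => t M e c t0 *.
  have h1 : tau - theta' - t <= c - M by lra.
  have h2 : 0 <= gamma * (tau - theta') by rewrite mulr_ge0 ?subr_ge0// ltW.
  have h3 : gamma * t <= t by rewrite ler_piMl.
  have h4 : (1 + gamma) * (tau - theta' - t) <= (1 + gamma) * (c - M).
    by rewrite ler_wpM2l// addr_ge0// ltW.
  by apply: le_trans h4; lra.
split.
- exact: bmfN.
- by move=> x; rewrite normrN normr_pm invf_ge1.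
right; apply: le_trans (corr_gap_le D (bH eta) mhstar) _; rewrite lerD2r descentE//.
have := le_max_corr P Hhstar.
move: nh dev; rewrite !ler_norml => /andP[n1 n2] /andP[d1 d2].
move: emp n1 n2 d1 d2 wl; move: (noise _ _ _ _ _ _) (emp_corr _ _) (corr P w) (corr P hstar) (max_corr _ _) t0.
move: (thr _) => t M e c c' mc t0 *.
have h1 : gamma * c' <= tau + theta' + eps0.
  have : gamma * c' <= gamma * mc by rewrite ler_wpM2l// ltW.
  lra.
have h2 : c' <= (tau + theta' + eps0) / gamma by rewrite ler_pdivlMr// mulrC.
have h3 : t <= t / gamma by rewrite ler_peMr// invf_ge1.
have h4 : (1 + gamma) * (c' - M) <= (1 + gamma) * ((tau + theta' + eps0) / gamma + t / gamma).
  by rewrite ler_wpM2l// ?addr_ge0 ?(ltW gamma_gt0)//; lra.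
apply: le_trans h4 _.
have -> : 2 * eps0 / gamma + 2 * (tau + theta') / gamma + 2 * t / gamma =
    2 * ((tau + theta' + eps0) / gamma + t / gamma) by ring.
apply: ler_wpM2r; last by have := gamma_le1; lra.
rewrite -mulrDl mulr_ge0 ?invr_ge0 ?(ltW gamma_gt0)// !addr_ge0//.
exact: le_trans tau_ge.
Qed.

Fixpoint good hist : Prop :=
  if hist is r :: hist' then
    round_ok (size hist') (ensemble eta hist') r.2 /\ good hist'
  else True.

Lemma good_regular hist : good hist -> regular gamma hist.
Proof. by elim: hist => [//|r hist IH] [[bv vb _] /IH]; split. Qed.

Fixpoint total_descent hist : R :=
  if hist is r :: hist' then
    descent D (ensemble eta hist') r.2 + total_descent hist'
  else 0.

Lemma bmf_potential H : bmf H -> bmf (fun z : X * bool => potential (margin H z)).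
Proof.
move=> bH; apply: bmf_comp (bmf_margin bH) _.
  move=> x; apply/differentiable_continuous/derivable1_diffP.
  by have := is_derive_potential x => dx; exact: ex_derive.
move=> M; exists (2 + M) => x xM.
have [c _] := MVT_is_derive 0 x (@is_derive_potential R).
rewrite potential0 subr0 => /eqP; rewrite subr_eq addrC => /eqP ->.
apply: le_trans (ler_normD _ _) _; rewrite (ger0_norm (ler0n _ 2)) lerD2l.
by apply: le_trans xM; rewrite normrM ler_piMl// normr_dpotential.
Qed.

(** The smoothness inequality is summed from the initial potential 2. A round moves every margin by
    at most eta / gamma = sigma, whence the error sigma^2. *)
Lemma potential_bound hist : regular gamma hist ->
  Ex D (fun z => potential (margin (ensemble eta hist) z)) <=
    2 - eta * total_descent hist + (size hist)%:R * sigma ^+ 2.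
Proof.
elim: hist => [_|[Dt v] hist IH [[/= bv vb] rh]].
  rewrite /= mulr0 mul0r subr0 addr0 -[leRHS](Ex_cst D); apply: le_Ex.
  - by apply: bmf_potential; exact: bmf_cst.
  - exact: bmf_cst.
  - by move=> z; rewrite /margin mulr0 potential0.
have bH := bmf_ensemble eta rh.
pose dp z := margin v z * dpotential (margin (ensemble eta hist) z).
have bdp : bmf dp by exact: bmf_descent.
apply: (@le_trans _ _ (Ex D (fun z => potential (margin (ensemble eta hist) z) +
    (eta * dp z + sigma ^+ 2)))).
  have bE : bmf (fun x => ensemble eta hist x + eta * v x).
    by apply: bmfD => //; exact: bmfZ.
  apply: le_Ex.
  - exact: bmf_potential.
  - apply: bmfD; first exact: bmf_potential.
    by apply: bmfD; [exact: bmfZ|exact: bmf_cst].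
  - move=> z; have -> : margin (fun x => ensemble eta hist x + eta * v x) z =
        margin (ensemble eta hist) z + eta * margin v z by rewrite /margin; ring.
    apply: le_trans (potential_smooth _ _) _.
    rewrite -addrA lerD2l /dp mulrA lerD2l -real_normK ?num_real// lerXn2r ?nnegrE ?(ltW s0)//.
    rewrite sigmaE normrM gtr0_norm// ler_wpM2l ?(ltW eta_gt0)//.
    by rewrite /margin normrM normr_pm mul1r.
rewrite ExD; [|exact: bmf_potential|by apply: bmfD; [exact: bmfZ|exact: bmf_cst]].
rewrite ExD; [|exact: bmfZ|exact: bmf_cst].
rewrite ExZ// Ex_cst.
have := IH rh; rewrite /= /descent -/dp -[(size hist).+1%:R]natr1.
move: (Ex D _) (Ex D dp) (total_descent _) (size _)%:R => a b c e.
rewrite mulrDr mulrN mulrDl mul1r.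
by move: (eta * b) (eta * c) (e * sigma ^+ 2) => *; lra.
Qed.

Variables (kappa E : R).
Hypotheses (kappa1 : kappa <= (tau - theta') / gamma)
  (kappa2 : kappa <= E - 2 * (tau + theta') / gamma).

(** When every gap is large, both alternatives of [round_ok] give a descent of at least [kappa]
    minus 2 / gamma times the threshold. The geometric parts of the thresholds sum to the fraction
    with denominator [sigma]. *)
Lemma total_descent_ge hist : good hist ->
    (forall i, (0 < i <= size hist)%N ->
       2 * eps0 / gamma + E < gap (ensemble eta (drop i hist))) ->
  kappa * (size hist)%:R
    - 2 / gamma * (2 * ((1 - (1 - sigma) ^+ size hist) / sigma) + (size hist)%:R * theta)
  <= total_descent hist.
Proof.
elim: hist => [_ _|[Dt v] hist IH [/= rok gh] bad].
  by rewrite /= expr0 subrr mul0r !(mulr0, mul0r) addr0 mulr0 subr0.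
have h1 : kappa - 2 / gamma * thr (size hist) <= descent D (ensemble eta hist) v.
  (* Dropping one record gives the ensemble on which the latest round acted. *)
  have := bad 1%N isT; rewrite /= drop0; case: rok => _ _ [a|b] g.
    apply: le_trans a; rewrite mulrBl lerB//.
    by rewrite mulrAC.
  move: g b kappa2 => g b; move: (gap _) (descent _ _ _) g b => x y.
  have -> : 2 * thr (size hist) / gamma = 2 / gamma * thr (size hist) by ring.
  move: (2 / gamma * _) (2 * eps0 / gamma) (2 * (tau + theta') / gamma) => *; lra.
have := IH gh _; move=> /(_ _)/wrap[|h2].
  move=> i /andP[i0 i1]; apply: (bad i.+1).
  by rewrite /= ltnS.
apply: le_trans (lerD h1 h2); rewrite le_eqVlt; apply/orP; left; apply/eqP.
rewrite /= /threshold -[(size hist).+1%:R]natr1 exprS.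
move: ((1 - sigma) ^+ _) (_%:R) => p e.
by field; rewrite !gt_eqF.
Qed.

(** Otherwise the potential would become negative. The constant 6 is the initial potential 2 plus 4,
    the total loss due to the a priori noise bound of the first round: eta times 4 / (gamma sigma) =
    4 / eta. *)
Lemma exists_small_gap hist : good hist ->
    6 < (kappa - 2 * theta / gamma - eta / gamma ^+ 2) * (eta * (size hist)%:R) ->
  exists2 i, (0 < i <= size hist)%N &
    gap (ensemble eta (drop i hist)) <= 2 * eps0 / gamma + E.
Proof.
move=> gh big; apply: contrapT => none.
have := total_descent_ge gh _; move=> /(_ _)/wrap[|h1].
  by move=> i i0; rewrite ltNge; apply/negP => gi; apply: none; exists i.
have h2 := potential_bound (good_regular gh).
have h3 : 0 <= Ex D (fun z => potential (margin (ensemble eta hist) z)).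
  by apply: Ex_ge0 => z; exact: potential_ge0.
have h4 : 2 / gamma * (2 * ((1 - (1 - sigma) ^+ size hist) / sigma)) <= 4 / eta.
  have -> : 4 / eta = 2 / gamma * (2 * (1 / sigma)).
    by rewrite sigmaE; field; rewrite !gt_eqF.
  rewrite ler_wpM2l ?divr_ge0 ?(ltW gamma_gt0)// ler_wpM2l//.
  rewrite ler_wpM2r ?invr_ge0 ?(ltW s0)// lerBlDr lerDl exprn_ge0// subr_ge0//.
have h5 : eta * (kappa * (size hist)%:R - (4 / eta + 2 / gamma * ((size hist)%:R * theta)))
    <= eta * total_descent hist.
  rewrite ler_wpM2l ?(ltW eta_gt0)//; apply: le_trans h1.
  by rewrite lerD2l lerN2 mulrDr lerD2r.
move: big h2 h3 h5; move: (Ex D _) (total_descent hist) (size hist)%:R => a b n.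
rewrite sigmaE => big h2 h3 h5.
have E1 : eta * (kappa * n - (4 / eta + 2 / gamma * (n * theta))) =
    (kappa - 2 * theta / gamma) * (eta * n) - 4.
  by field; rewrite !gt_eqF.
have E2 : (kappa - 2 * theta / gamma - eta / gamma ^+ 2) * (eta * n) =
    (kappa - 2 * theta / gamma) * (eta * n) - n * (eta / gamma) ^+ 2.
  by field; rewrite !gt_eqF.
move: big h2 h3 h5; rewrite E1 E2.
move: (eta * b) (n * _ ^+ 2) (_ * (eta * n)) => *; lra.
Qed.

End potential_descent.

(** * Backward analysis of a run *)

Section dynamic_programming.
Context {R : realType} d {X : measurableType d} {B : {fset (X -> bool)}}.
Variables (D : probability (X * bool)%type R) (W : learner R B) (gamma eta : R).
Variables (eta_gt0 : 0 < eta) (sigma tau : R) (S m : nat).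
Hypotheses (gamma01 : 0 < gamma <= 1) (sigmaE : sigma = eta / gamma)
  (sigma_le1 : sigma <= 1) (S_gt0 : (0 < S)%N) (m_gt0 : (0 < m)%N).
Local Notation hist_t := (@history R d X S).
Local Notation phi := (@potential R).
Implicit Types (hist : hist_t) (Dt : S.-tuple (X * bool)%type).
Local Notation play := (rounds D W gamma eta_gt0 sigma tau m phi).

Let gamma_gt0 : 0 < gamma. Proof. by case/andP: gamma01. Qed.

Let s0 : 0 < sigma. Proof. exact: (sigma_gt0 eta_gt0 gamma_gt0 sigmaE). Qed.

Let s01 : 0 <= sigma <= 1. Proof. by rewrite (ltW s0) sigma_le1. Qed.

Let monotone_W n s := monotone_draw_pmf (@learner_ge0 _ _ _ _ W n s)
  (@learner_sum1 _ _ _ _ W n s).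

Lemma monotone_rounds n hist : monotone_law (play n hist).
Proof.
elim: n hist => [|n IH] hist /=; first exact: monotone_ret.
apply: monotone_bind => [|Dt]; first exact: monotone_iid (monotone_draw D).
apply: monotone_bind => [|s']; first exact: (monotone_iid _ (monotone_resample eta_gt0 sigma S_gt0 _ _)).
apply: monotone_bind => [|w]; [exact: monotone_W|exact: IH].
Qed.

(** The hypothesis of the newest round enters a label probability only one round later. *)
Lemma well_posed_head Dt v v' hist :
  well_posed eta sigma phi ((Dt, v) :: hist) -> well_posed eta sigma phi ((Dt, v') :: hist).
Proof. by []. Qed.

Lemma well_posed_tail r hist :
  well_posed eta sigma phi (r :: hist) -> well_posed eta sigma phi hist.
Proof. by case: r => Dt v []. Qed.

Variables (F : hist_t -> \bar R).
Hypothesis F_ge0 : forall hist, (0 <= F hist)%E.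
Hypothesis F_ill : forall hist, ~ well_posed eta sigma phi hist -> F hist = 1%E.

Let play_round n hist Dt : \bar R :=
  iid m (resample eta_gt0 sigma phi Dt hist) (fun s' =>
    draw_pmf (W m s') (fun w : B =>
      play n ((Dt, next_hypothesis gamma eta tau hist s' (val w)) :: hist) F)).

Let play_round_ge0 n hist Dt : (0 <= play_round n hist Dt)%E.
Proof.
apply: (law_ge0 (monotone_iid _ (monotone_resample eta_gt0 sigma S_gt0 _ _))) => s.
apply: (law_ge0 (monotone_W _)) => w.
exact: (law_ge0 (monotone_rounds _ _)).
Qed.

(** Ill-posedness persists in every continuation, and an ill-posed history has value 1 because the
    target event is conditional on well-posedness. *)
Lemma rounds_ill_posed n hist : ~ well_posed eta sigma phi hist -> play n hist F = 1%E.
Proof.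
elim: n hist => [|n IH] hist ill /=; first exact: F_ill.
rewrite /bind -[RHS](law_cst1 (monotone_iid S (monotone_draw D))).
congr (iid S _ _); apply/funext => Dt.
rewrite -[RHS](law_cst1 (monotone_iid m (monotone_resample eta_gt0 sigma S_gt0 Dt hist))).
congr (iid m _ _); apply/funext => s'.
rewrite -[RHS](law_cst1 (monotone_W s')); congr (draw_pmf _ _); apply/funext => w.
by apply: IH => /well_posed_tail.
Qed.

Variables (HH : set (X -> bool)) (mW : R -> R -> option nat) (hstar : X -> bool).
Hypotheses (mB : forall b : X -> bool, b \in B -> measurable_fun setT b)
  (mHH : forall h, HH h -> measurable_fun setT h) (Hhstar : HH hstar).
Variables (eps0 delta0 delta rho theta theta' lam V : R) (m0 T : nat).
Hypothesis weakW : agnostic_weak_learner gamma HH W mW.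
Hypotheses (mWE : mW eps0 delta0 = Some m0) (m0m : (m0 <= m)%N).
Hypotheses (eps0_gt0 : 0 < eps0) (delta0_gt0 : 0 < delta0) (delta_ge0 : 0 <= delta)
  (rho_ge0 : 0 <= rho) (theta_ge0 : 0 <= theta) (theta'4 : 0 < theta' <= 4)
  (tau_ge : theta' <= tau).
Hypothesis m_large :
  2 * (#|` B|)%:R * expR (- (m%:R * theta' ^+ 2 / 32)) <= delta.
Hypotheses (lam_ge0 : 0 <= lam) (lam_small : 8 * lam * sigma <= S%:R)
  (VE : V = 32 * lam ^+ 2 * sigma / S%:R).

Local Notation okhist := (good D eta gamma sigma hstar eps0 tau theta theta').
Local Notation thr := (threshold sigma theta).

Hypothesis F_good : forall hist, okhist hist -> size hist = T ->
  ((1 - rho)%:E <= F hist)%E.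

(* The functions, with signs, on which the noise has to be small. *)
Definition tested : seq ((X -> bool) * bool) :=
  [seq (h, b) | h <- hstar :: (B : seq (X -> bool)), b <- [:: true; false]].

Lemma tested_measurable h b : (h, b) \in tested -> measurable_fun setT h.
Proof.
move=> /allpairsP[[g c] /= [+ _ [-> _]]]; rewrite inE => /orP[/eqP->|/mB//].
exact: mHH.
Qed.

Definition tails_before hist n : R := \sum_(j < n) \sum_(k <- tested)
  tail_before D eta sigma lam theta V hist k.1 k.2 j.

Definition tails_after Dt hist n : R := \sum_(j < n) \sum_(k <- tested)
  tail_after D eta sigma lam theta V Dt hist k.1 k.2 j.

Lemma tails_before_ge0 hist n : 0 <= tails_before hist n.
Proof. by do 2 apply: sumr_ge0 => ? _; exact: expR_ge0. Qed.

Lemma tails_afterS Dt v hist n : tails_after Dt hist n.+1 =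
  \sum_(k <- tested) tail_after D eta sigma lam theta V Dt hist k.1 k.2 0 +
  tails_before ((Dt, v) :: hist) n.
Proof.
rewrite /tails_after big_ord_recl; congr (_ + _).
by apply: eq_bigr => j _; apply: eq_bigr => k _; rewrite -tail_afterS.
Qed.

Let rate := delta0 + delta.

Let rate_ge0 : 0 <= rate. Proof. by rewrite addr_ge0// ltW. Qed.

(** The invariant of the backward induction: success with [n] rounds left can fail through excessive
    future noise, a failure of the weak learner or of its empirical test in one of these rounds, or
    the post-selection. *)
Let bound hist n : R := 1 - tails_before hist n - n%:R * rate - rho.

Let bound_le1 hist n : bound hist n <= 1.
Proof.
rewrite /bound -!addrA -[leRHS]addr0 lerD2l -!opprD oppr_le0.
by rewrite !addr_ge0 ?tails_before_ge0// mulr_ge0.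
Qed.

(** Three cases: an ill-posed history has value 1; if a tested noise exceeds the threshold, its
    exponential is at least 1 and the claimed bound is not positive; otherwise [weak_learning_step]
    applies. *)
Lemma play_round_lower_bound n hist Dt : okhist hist -> (n.+1 + size hist = T)%N ->
    (forall hist', okhist hist' -> (n + size hist' = T)%N ->
      ((bound hist' n)%:E <= play n hist' F)%E) ->
  ((1 - tails_after Dt hist n.+1 - n.+1%:R * rate - rho)%:E <=
     play_round n hist Dt)%E.
Proof.
move=> ok sz IH; rewrite (tails_afterS Dt (fun=> 0)).
set first_tail := \sum_(k <- tested) _.
have first_ge0 : 0 <= first_tail by apply: sumr_ge0 => k _; exact: expR_ge0.
(* The zero hypothesis is a placeholder: the tails and the well-posedness of this history do not
   depend on the newest hypothesis, which is still to be chosen. *)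
set hist0 := (Dt, fun=> 0) :: hist.
have boundE : 1 - (first_tail + tails_before hist0 n) - n.+1%:R * rate - rho =
    bound hist0 n - rate - first_tail by rewrite /bound -[n.+1%:R]natr1; ring.
rewrite boundE; have b1 := bound_le1 hist0 n.
have [wp|ill] := pselect (well_posed eta sigma phi hist0); last first.
  have -> : play_round n hist Dt = 1%E.
    rewrite /play_round.
    rewrite -[RHS](law_cst1 (monotone_iid m (monotone_resample eta_gt0 sigma S_gt0 Dt hist))).
    congr (iid m _ _); apply/funext => s'.
    rewrite -[RHS](law_cst1 (monotone_W s')); congr (draw_pmf _ _); apply/funext => w.
    by apply: rounds_ill_posed => wp; apply: ill; exact: well_posed_head wp.
  by rewrite lee_fin; move: rate_ge0; lra.
case: (boolP (all (fun k => pm k.2 * noise D eta sigma Dt hist k.1 <= thr (size hist)) tested)); last first.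
  move=> /allPn[k kt]; rewrite -ltNge => large.
  apply: le_trans (play_round_ge0 n hist Dt); rewrite lee_fin.
  have : 1 <= first_tail.
    rewrite /first_tail (big_rem k)//= -[leLHS]addr0 lerD//.
      exact: tail_after0.
    by apply: sumr_ge0 => k' _; exact: expR_ge0.
  by move: rate_ge0; lra.
move=> /allP small; have small' h : h \in hstar :: (B : seq _) ->
    `|noise D eta sigma Dt hist h| <= thr (size hist).
  move=> hin; rewrite ler_norml; apply/andP; split.
    rewrite lerNl -mulN1r; apply: (small (h, false)).
    by apply/allpairsP; exists (h, false).
  by rewrite -[leLHS]mul1r; apply: (small (h, true)); apply/allpairsP; exists (h, true).
have l0 := atoms_ge0 eta_gt0 s01 wp; have l1 := atoms_sum1 eta sigma S_gt0 Dt hist.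
have [P [PE Pm]] := atomic_probability l0 l1.
have PcE h : measurable_fun setT h -> corr P h = atom_mean eta sigma Dt hist (agreement h).
  by move=> mh; rewrite corrE PE//; exact: bmf_agreement.
apply: (@le_trans _ _ (bound hist0 n - delta0 - delta)%:E).
  by rewrite lee_fin /rate; lra.
apply: (@weak_learning_step _ _ _ _ W _ _ P (monotone_resample eta_gt0 sigma S_gt0 Dt hist)
  (resample_atomic eta_gt0 s01 S_gt0 wp) l0 PE Pm mB m theta' delta delta0 (bound hist0 n)
  [set w : B | gamma * max_corr P HH - eps0 <= corr P (val w)] m_gt0 theta'4 m_large b1
  _ (fun s w => play n ((Dt, next_hypothesis gamma eta tau hist s (val w)) :: hist) F)).
- exact: (weakW eps0_gt0 delta0_gt0 mWE m0m P).
- by move=> s w; exact: (law_ge0 (monotone_rounds _ _)).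
move=> s w /= wl dev; apply: IH; last by rewrite addnS -addSn.
have mw : measurable_fun setT (val w) by apply: mB; exact: valP.
have theta'_ge0 : 0 <= theta' by case/andP: theta'4 => /ltW.
have nw : `|noise D eta sigma Dt hist (val w)| <= thr (size hist).
  by apply: small'; rewrite inE (valP w) orbT.
have nh : `|noise D eta sigma Dt hist hstar| <= thr (size hist).
  by apply: small'; rewrite inE eqxx.
split => //=; exact: (next_round_ok eta_gt0 gamma01 sigmaE sigma_le1 (ltW eps0_gt0)
  theta_ge0 theta'_ge0 tau_ge (mHH Hhstar) Hhstar mw PcE (good_regular ok) nw nh wl dev).
Qed.

(** The bound after drawing the sample is a constant minus exponentials dominated by products, so
    [iid_lower_bound] integrates it; [tail_expectation] converts the result into the bound before
    the draw. *)
Lemma rounds_lower_bound n hist : okhist hist -> (n + size hist = T)%N ->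
  ((bound hist n)%:E <= play n hist F)%E.
Proof.
elim: n hist => [|n IH] hist ok sz.
  apply: le_trans (F_good ok sz).
  by rewrite lee_fin /bound /tails_before big_ord0 mul0r !subr0.
pose idx := [seq (j, k) | j <- index_enum 'I_n.+1, k <- tested].
(* The choice ranges over all functions, so indices outside [tested], possibly non-measurable,
   receive a dummy pair. *)
have /choice[cg cgP] : forall k : 'I_n.+1 * ((X -> bool) * bool),
    exists cg : R * (X * bool -> R), bmf cg.2 /\ (k.2 \in tested ->
      (forall Dt, tail_after D eta sigma lam theta V Dt hist k.2.1 k.2.2 k.1 <=
         cg.1 * \prod_(i < S) cg.2 (tnth Dt i)) /\
      cg.1 * Ex D cg.2 ^+ S <= tail_before D eta sigma lam theta V hist k.2.1 k.2.2 k.1).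
  move=> [j [h b]] /=; case: (boolP ((h, b) \in tested)) => [ht|_]; last first.
    by exists (0, fun=> 0); split => //; exact: bmf_cst.
  have [c [g [_ bg g1 g2]]] := tail_expectation D eta_gt0 gamma_gt0 sigmaE sigma_le1 S_gt0
    theta lam_ge0 lam_small VE b j (good_regular ok) (tested_measurable ht).
  by exists (c, g).
have H := @iid_lower_bound R _ _ D S _ idx (1 - n.+1%:R * rate - rho)
  (fun k => (cg k).1) (fun k => (cg k).2) (play_round n hist) (fun k => (cgP k).1)
  (play_round_ge0 n hist).
apply: (@le_trans _ _ _ _ _ _ (H _)) => [|Dt].
  rewrite lee_fin /bound; set s := \sum_(k <- idx) _.
  suff : s <= tails_before hist n.+1 by lra.
  rewrite /s /idx big_allpairs; apply: ler_sum => j _.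
  rewrite [leLHS]big_seq [leRHS]big_seq; apply: ler_sum => k kt.
  by have [_] := (cgP (j, k)).2 kt.
apply: le_trans (play_round_lower_bound Dt ok sz IH).
rewrite lee_fin; set s := \sum_(k <- idx) _.
suff : tails_after Dt hist n.+1 <= s by lra.
rewrite /s /idx big_allpairs; apply: ler_sum => j _.
rewrite [leLHS]big_seq [leRHS]big_seq; apply: ler_sum => k kt.
by have [+ _] := (cgP (j, k)).2 kt.
Qed.

End dynamic_programming.

(** * Post-selection on a fresh sample *)

Section boosting_guarantee.
Context {R : realType} d {X : measurableType d} {B : {fset (X -> bool)}}.
Variables (D : probability (X * bool)%type R) (eta gamma : R) (S : nat).
Local Notation hist_t := (@history R d X S).
Implicit Types (hist : hist_t).

Lemma regular_drop i hist : regular gamma hist -> regular gamma (drop i hist).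
Proof.
by elim: hist i => [|r hist IH] [|i]//= [_ rh]; exact: IH.
Qed.

(** By a union bound over the candidates, all empirical correlations are within [theta] of the true
    ones; then any empirical maximizer loses at most 2 theta against candidate [i0], however ties
    are broken. *)
Lemma post_selection hist (S0 i0 : nat) (theta delta : R)
    (E : set (S0.-tuple (X * bool)%type)) :
    regular gamma hist -> (0 < S0)%N -> 0 < theta <= 4 ->
    2 * expR (- (S0%:R * theta ^+ 2 / 32)) <= delta ->
    (0 < i0 <= size hist)%N ->
    (forall D0, (forall hbar, outputs eta (hist, D0) hbar ->
       corr D (sign (ensemble eta (drop i0 hist))) - 2 * theta <= corr D hbar) -> E D0) ->
  ((1 - (size hist)%:R * delta)%:E <= iid S0 (draw D) (fun D0 => (\1_E D0)%:E))%E.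
Proof.
move=> rh S0_gt0 t04 dl i0P EP.
pose c i := sign (ensemble eta (drop i hist)).
have mc i : measurable_fun setT (c i).
  have [mH _] := bmf_ensemble eta (regular_drop i rh).
  by apply: measurable_fun_ler => //; exact: measurable_cst.
pose idx := [seq (i, b) | i <- iota 1 (size hist), b <- index_enum bool].
pose g (k : nat * bool) := tilt D (c k.1) (theta / 16 * pm k.2).
have H := @iid_lower_bound R _ _ D S0 _ idx 1 (fun=> tail_weight S0 theta) g
  (fun D0 => (\1_E D0)%:E) (fun k => bmf_tilt D (mc k.1) _).
apply: (@le_trans _ _ _ _ _ _ (H _ _)) => [|D0|D0].
- rewrite lee_fin lerD2l lerN2 /idx big_allpairs.
  apply: (@le_trans _ _ (\sum_(i <- iota 1 (size hist)) delta)); last first.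
    by rewrite big_const_seq count_predT size_iota iter_addr_0 mulr_natl.
  apply: ler_sum => i _; apply: le_trans dl.
  apply: (@le_trans _ _ (\sum_(b : bool) expR (- (S0%:R * theta ^+ 2 / 32)))).
    by apply: ler_sum => b _; exact: Ex_tilt_le.
  by rewrite big_bool [leRHS]mulr_natl mulr2n.
- by rewrite lee_fin indicE.
rewrite lee_fin indicE; case: (boolP (D0 \in E)) => [_|/negP D0E].
  rewrite lerBlDr lerDl; apply: sumr_ge0 => k _.
  by rewrite mulr_ge0 ?expR_ge0// prodr_ge0// => i _; exact: tilt_ge0.
have [i iP dev] : exists2 i, (0 < i <= size hist)%N &
    theta < `|emp_corr D0 (c i) - corr D (c i)|.
  apply: contrapT => none; apply: D0E; apply/mem_set/EP => hbar [[j jP <-] best].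
  have small i : (0 < i <= size hist)%N -> `|emp_corr D0 (c i) - corr D (c i)| <= theta.
    by move=> iP; rewrite leNgt; apply/negP => dev; apply: none; exists i.
  have := small _ i0P; have := small _ jP.
  have : (emp_corr D0 (c i0) : R) <= emp_corr D0 (c j).
    by rewrite ler_wpM2l ?invr_ge0//; apply: best; exists i0.
  rewrite -/(c i0) -/(c j) !ler_norml => ? /andP[? ?] /andP[? ?]; lra.
have := deviation_le_tilt (mc i) S0_gt0 t04 dev.
rewrite subr_le0 => /le_trans; apply; rewrite /idx big_allpairs.
have iin : i \in iota 1 (size hist) by rewrite mem_iota add1n ltnS.
rewrite (big_rem i)//= -[leLHS]addr0 lerD//.
apply: sumr_ge0 => i' _; apply: sumr_ge0 => b _.
by rewrite mulr_ge0 ?expR_ge0// prodr_ge0// => ? _; exact: tilt_ge0.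
Qed.

End boosting_guarantee.

(** * The guarantee under numerical conditions on the parameters *)

Section guarantee.
Context {R : realType} d {X : measurableType d} {B : {fset (X -> bool)}}.
Variables (D : probability (X * bool)%type R) (HH : set (X -> bool)).
Variables (gamma eps delta eta : R) (eta_gt0 : 0 < eta) (sigma tau : R).
Variables (T S S0 r : nat).
Hypotheses (mB : forall b : X -> bool, b \in B -> measurable_fun setT b)
  (HH0 : HH !=set0) (mHH : forall h, HH h -> measurable_fun setT h).
Hypotheses (gamma01 : 0 < gamma <= 1) (eps02 : 0 < eps <= 2) (delta_gt0 : 0 < delta).
Hypotheses (sigmaE : sigma = eta / gamma) (sigma_le1 : sigma <= 1)
  (tauE : tau = gamma * eps / 8).
Hypotheses (S_gt0 : (0 < S)%N) (S0_gt0 : (0 < S0)%N) (r_gt0 : (0 < r)%N).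
Hypotheses (eta_small : eta <= gamma ^+ 2 * eps / 64) (T_large : 96 < eta * eps * T%:R).
Hypothesis S_large :
  2 * (1 + (#|` B|)%:R) * expR (- ((gamma * eps / 128) ^+ 2 * S%:R / (128 * sigma))) <= delta.
Hypothesis r_large :
  2 * (#|` B|)%:R * expR (- (r%:R * (gamma * eps / 32) ^+ 2 / 32)) <= delta.
Hypothesis S0_large :
  2 * expR (- (S0%:R * (eps / 8) ^+ 2 / 32)) <= delta.

Let gamma_gt0 : 0 < gamma. Proof. by case/andP: gamma01. Qed.

Let gamma_le1 : gamma <= 1. Proof. by case/andP: gamma01. Qed.

Let eps_gt0 : 0 < eps. Proof. by case/andP: eps02. Qed.

Let eps_le2 : eps <= 2. Proof. by case/andP: eps02. Qed.

Let s0 : 0 < sigma. Proof. exact: (sigma_gt0 eta_gt0 gamma_gt0 sigmaE). Qed.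

Let ge_gt0 : 0 < gamma * eps. Proof. exact: mulr_gt0. Qed.

Let ge_le2 : gamma * eps <= 2.
Proof. by apply: le_trans eps_le2; rewrite ler_piMl// ltW. Qed.

Let theta := gamma * eps / 128.

(** The maximizer of lam theta - 32 lam^2 sigma / S; the maximum is theta^2 S / (128 sigma). *)
Let lam := theta * S%:R / (64 * sigma).

Let V := 32 * lam ^+ 2 * sigma / S%:R.

Let theta_ge0 : 0 <= theta. Proof. by rewrite divr_ge0// ltW. Qed.

Let lam_ge0 : 0 <= lam.
Proof. by rewrite divr_ge0 ?mulr_ge0// ltW. Qed.

Let lam_small : 8 * lam * sigma <= S%:R.
Proof.
rewrite (_ : 8 * lam * sigma = theta / 8 * S%:R); last first.
  by rewrite /lam; field; rewrite gt_eqF.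
by rewrite ler_piMl// /theta; have := ge_le2; lra.
Qed.

Let tested_size hstar : size (@tested _ X B hstar) = (2 * (#|` B|).+1)%N.
Proof. by rewrite size_allpairs /= mulnC. Qed.

(** On the empty history the predicted noise 2 cancels the geometric part of the threshold, leaving
    an exponent of at most [V - lam * theta] for each horizon and each of the 2 (|B| + 1) tested
    pairs. *)
Lemma tails_initial hstar :
  @tails_before R d X B D eta sigma S hstar theta lam V [::] T <= T%:R * delta.
Proof.
have q0 : 0 <= 1 - sigma by rewrite subr_ge0.
have V0 : 0 <= V by rewrite /V divr_ge0// mulr_ge0 ?(ltW s0)// mulr_ge0// exprn_ge0.
have tail_le h b (j : nat) : tail_before D eta sigma lam theta V ([::] : history S) h b j <=
    expR (- (theta ^+ 2 * S%:R / (128 * sigma))).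
  rewrite /tail_before ler_expR /threshold /= add0n.
  have -> : - (theta ^+ 2 * S%:R / (128 * sigma)) = V - lam * theta.
    by rewrite /V /lam; field; rewrite pnatr_eq0 -lt0n S_gt0 gt_eqF.
  have : V * (1 - (1 - sigma) ^+ j.+1) <= V.
    by rewrite ler_piMr// gerBl exprn_ge0.
  move: (V * _) ((1 - sigma) ^+ j) => a q aV.
  rewrite (_ : _ + a - _ = a - lam * theta) ?lerD2r//; ring.
apply: (@le_trans _ _ (\sum_(j < T) \sum_(k <- @tested _ X B hstar)
    expR (- (theta ^+ 2 * S%:R / (128 * sigma))))).
  by apply: ler_sum => j _; apply: ler_sum => k _.
rewrite sumr_const card_ord big_const_seq count_predT iter_addr_0 tested_size.
rewrite -[leLHS]mulr_natl ler_wpM2l//; apply: le_trans S_large.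
by rewrite -[leLHS]mulr_natl natrM -[(#|` B|).+1]add1n natrD.
Qed.

Lemma boost_guarantee (W : learner R B) (mW : R -> R -> option nat) :
  agnostic_weak_learner gamma HH W mW ->
  forall (eps0 delta0 : R) (m0 : nat), 0 < eps0 -> 0 < delta0 ->
  mW eps0 delta0 = Some m0 ->
  ((1 - 10 * delta0 * T%:R - 10 * delta * T%:R)%:E <=
   Prob (boost D W gamma eta_gt0 sigma tau T S S0 (m0 + r)%N potential)
     [set run | well_posed eta sigma potential run.1 ->
        forall hbar : X -> bool, outputs eta run hbar ->
        (max_corr D HH - 2 * eps0 / gamma - eps <= corr D hbar)%R])%E.
Proof.
move=> WL eps0 delta0 m0 eps0_gt0 delta0_gt0 mWE.
(* The supremum need not be attained; [hstar] comes within eps / 16 of it. *)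
have [hstar Hhstar hstarP] := max_corr_adherent D HH0 (divr_gt0 eps_gt0 (ltr0n _ 16)).
set E := [set run | _]; rewrite /Prob /boost /bind /ret.
pose F (hist : history S) : \bar R :=
  iid S0 (draw D) (fun D0 => (\1_E (hist, D0))%:E).
rewrite -/F.
have F_ge0 hist : (0 <= F hist)%E.
  apply: (law_ge0 (monotone_iid _ (monotone_draw D))) => D0.
  by rewrite lee_fin indicE.
have F_ill hist : ~ well_posed eta sigma potential hist -> F hist = 1%E.
  move=> ill; rewrite -[RHS](law_cst1 (monotone_iid S0 (monotone_draw D))).
  rewrite /F; congr (iid S0 _ _); apply/funext => D0.
  by rewrite indicE mem_set// => /ill.
have F_good hist : good D eta gamma sigma hstar eps0 tau theta (gamma * eps / 32) hist ->
    size hist = T -> ((1 - T%:R * delta)%:E <= F hist)%E.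
  (* Here [E] is eps / 2 and [kappa] is 3 eps / 32. Two losses of at most eps / 64 leave eps / 16,
     and [T_large] makes eps / 16 times eta T exceed 96 / 16 = 6. *)
  move=> ok sz; have k1 : 3 / 32 * eps <= (tau - gamma * eps / 32) / gamma.
    by rewrite tauE le_eqVlt; apply/orP; left; apply/eqP; field; rewrite gt_eqF.
  have k2 : 3 / 32 * eps <= eps / 2 - 2 * (tau + gamma * eps / 32) / gamma.
    rewrite tauE (_ : _ - _ = 3 / 16 * eps); last by field; rewrite gt_eqF.
    by have := eps_gt0; lra.
  have [|i0 i0P small] := exists_small_gap eta_gt0 gamma01 sigmaE sigma_le1 k1 k2 ok.
    rewrite sz (_ : 2 * theta / gamma = eps / 64); last first.
      by rewrite /theta; field; rewrite gt_eqF.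
    have h1 : eta / gamma ^+ 2 <= eps / 64.
      by rewrite ler_pdivrMr ?exprn_gt0// mulrC mulrA.
    apply: (@lt_le_trans _ _ (eps / 16 * (eta * T%:R))); last first.
      rewrite ler_wpM2r ?mulr_ge0 ?(ltW eta_gt0)//; lra.
    have -> : eps / 16 * (eta * T%:R) = (eta * eps * T%:R) / 16 by ring.
    by have := T_large; lra.
  rewrite -sz; apply: (post_selection (theta := eps / 8) _ S0_gt0 _ S0_large i0P).
  - exact: good_regular ok.
  - by apply/andP; have := eps_gt0; have := eps_le2; split; lra.
  (* The losses are eps / 16 for [hstar], eps / 2 for the gap and eps / 4 for the post-selection, in
     total less than eps. *)
  move=> D0 best _ hbar /best; move: small; rewrite /gap.
  move: (corr D (sign _)) (corr D hbar) (2 * eps0 / gamma) hstarP eps_gt0 => *.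
  lra.
have rho_ge0 : 0 <= T%:R * delta by rewrite mulr_ge0// ltW.
have m_gt0 : (0 < m0 + r)%N by rewrite addn_gt0 r_gt0 orbT.
have tau_ge : gamma * eps / 32 <= tau by rewrite tauE; have := ge_gt0; lra.
have theta'4 : 0 < gamma * eps / 32 <= 4.
  by apply/andP; have := ge_gt0; have := ge_le2; split; lra.
have m_large : 2 * (#|` B|)%:R * expR (- ((m0 + r)%:R * (gamma * eps / 32) ^+ 2 / 32)) <= delta.
  apply: le_trans r_large; rewrite ler_wpM2l ?mulr_ge0// ler_expR lerN2.
  by rewrite ler_wpM2r ?invr_ge0// ler_wpM2r ?sqr_ge0// ler_nat leq_addl.
have := rounds_lower_bound eta_gt0 gamma01 sigmaE sigma_le1 S_gt0 m_gt0 F_ge0 F_ill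
  mB mHH Hhstar WL mWE (leq_addr r m0) eps0_gt0 delta0_gt0 (ltW delta_gt0) rho_ge0
  theta_ge0 theta'4 tau_ge m_large lam_ge0 lam_small erefl F_good (n := T) (hist := [::]) I
  (addn0 T).
apply: le_trans; rewrite lee_fin.
have : 0 <= T%:R * delta0 by rewrite mulr_ge0// ltW.
have -> : 1 - 10 * delta0 * T%:R - 10 * delta * T%:R =
  1 - 10 * (T%:R * delta0) - 10 * (T%:R * delta) by ring.
(* The total failure probability is at most T delta0 + 3 T delta: noise, empirical tests and
   post-selection each cost T delta. *)
rewrite mulrDr; move: (tails_initial hstar) rho_ge0.
by move: (tails_before _ _ _ _ _ _ _ _ _) (T%:R * delta) (T%:R * delta0) => *; lra.
Qed.

End guarantee.

(** * Choice of the parameters *)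

Section parameters.
Context {R : realType}.
Implicit Types (gamma eps delta q : R).

Lemma le1_ln (x : R) : 4 <= x -> 1 <= ln x.
Proof.
move=> x4; have x0 : 0 < x by lra.
rewrite -ler_expR lnK ?posrE//; apply: le_trans x4.
have h : expR (2^-1 : R) <= 2.
  have := expR_ge1Dx (- 2^-1 : R); rewrite expRN => h.
  rewrite -[leRHS]invrK -[leLHS]invrK lef_pV2 ?posrE ?invr_gt0 ?expR_gt0//; lra.
have -> : expR (1 : R) = expR (2%:R * 2^-1) by congr expR; lra.
rewrite expRM_natl (_ : 4 = 2 ^+ 2); last by ring.
by rewrite lerXn2r ?nnegrE ?expR_ge0.
Qed.

Section polylog.
Variables (gamma eps delta q : R).
Hypotheses (gamma01 : 0 < gamma <= 1) (eps_gt0 : 0 < eps) (delta_gt0 : 0 < delta)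
  (q_ge1 : 1 <= q).
Local Notation L := (polylog_base gamma eps delta q).

Let gammaV : 1 <= gamma^-1.
Proof. by have /andP[g0 g1] := gamma01; rewrite invf_ge1. Qed.

Let epsV : 0 < eps^-1. Proof. by rewrite invr_gt0. Qed.

Let deltaV : 0 < delta^-1. Proof. by rewrite invr_gt0. Qed.

Lemma polylog_ge1 : 1 <= L.
Proof. by apply: le1_ln; move: gammaV epsV deltaV q_ge1; lra. Qed.

Lemma ln_le_polylog : ln q <= L.
Proof. by rewrite ler_ln ?posrE; move: gammaV epsV deltaV q_ge1; lra. Qed.

Lemma lnV_le_polylog : - ln delta <= L.
Proof.
by rewrite -lnV ?posrE// ler_ln ?posrE//; move: gammaV epsV deltaV q_ge1; lra.
Qed.

End polylog.

Lemma ln2_le1 : ln (2 : R) <= 1.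
Proof. by have := @le_ln1Dx R 1; rewrite (_ : 1 + 1 = 2)//; apply; lra. Qed.

Lemma mulr_expRN_le (A c delta : R) : 0 < A -> 0 < delta -> ln A - ln delta <= c ->
  A * expR (- c) <= delta.
Proof.
move=> A0 d0 Ac; rewrite expRN ler_pdivrMr ?expR_gt0// -ler_pdivrMl//.
by rewrite -[leLHS]lnK ?posrE ?mulr_gt0 ?invr_gt0// ler_expR lnM ?posrE ?invr_gt0// lnV// addrC.
Qed.

End parameters.

Lemma nat_upper_approx (R : realType) (x : R) : 0 <= x ->
  exists n : nat, [/\ (0 < n)%N, x < n%:R & n%:R <= x + 1].
Proof.
move=> /truncn_itv/andP[x1 x2]; exists (Num.trunc x).+1; split => //.
by rewrite -natr1 lerD2r.
Qed.

(** * Arithmetic of the parameter bounds *)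

Section parameter_bounds.
Context {R : realType}.
Variables (L lc i C : R).
Hypotheses (L1 : 1 <= L) (lc1 : 1 <= lc) (i2 : 2^-1 <= i) (CE : C = 10 ^+ 9).

Lemma polylog_bound (c x n : R) : 0 <= c <= C -> 0 <= x -> n <= c * L * x + 1 ->
  n <= C * L ^+ 1 * (1 + x).
Proof.
move=> /andP[c0 cC] x0 /le_trans; apply.
have C1 : 1 <= C by rewrite CE; lra.
rewrite expr1 mulrDr mulr1 addrC lerD//; last first.
  by rewrite ler_wpM2r// ler_wpM2r// (le_trans ler01 L1).
by apply: (le_trans C1); rewrite ler_peMr// (le_trans ler01 C1).
Qed.

(** As [i] is at least 1/2, the roundings by 1 are absorbed into the leading terms. The product of
    the two leading constants is about 8.1 * 10^8, which is why [C] is 10^9. *)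
Lemma sample_bound (T S S0 : R) : 0 <= T -> 0 <= S ->
    T <= 64 * 96 * (lc * i ^+ 2) + 1 -> S <= 8 * 128 ^+ 2 * L * i + 1 ->
    S0 <= 64 ^+ 2 * L * i ^+ 2 + 1 ->
  T * S + S0 <= C * L ^+ 1 * (1 + lc * i ^+ 3).
Proof.
move=> T0 S0' Tle Sle S0le.
have i0 : 0 <= i by apply: le_trans i2; rewrite invr_ge0.
have isq : 4^-1 <= i ^+ 2.
  by rewrite (_ : 4^-1 = (2^-1) ^+ 2 :> R); [rewrite lerXn2r ?nnegrE|field].
have lci : i ^+ 2 <= lc * i ^+ 2 by rewrite ler_peMl// exprn_ge0.
have Li : i <= L * i by rewrite ler_peMl.
have T' : T <= (64 * 96 + 4) * (lc * i ^+ 2).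
  apply: le_trans Tle _; have := le_trans isq lci; move: (lc * i ^+ 2) => x ?.
  lra.
have S' : S <= (8 * 128 ^+ 2 + 2) * (L * i).
  apply: le_trans Sle _; rewrite -mulrA; have := le_trans i2 Li; move: (L * i) => x ?.
  lra.
have TS := ler_pM T0 S0' T' S'.
have E : (64 * 96 + 4) * (lc * i ^+ 2) * ((8 * 128 ^+ 2 + 2) * (L * i)) =
  (64 * 96 + 4) * (8 * 128 ^+ 2 + 2) * (L * (lc * i ^+ 3)) by ring.
rewrite {}E in TS.
have i3 : i ^+ 2 <= 2 * (lc * i ^+ 3).
  have : i ^+ 2 * 1 <= i ^+ 2 * (2 * (lc * i)).
    rewrite ler_wpM2l ?exprn_ge0//.
    have : i <= lc * i by rewrite ler_peMl.
    by move: i2; lra.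
  by rewrite mulr1 exprS; move=> /le_trans; apply; rewrite le_eqVlt; apply/orP; left; apply/eqP; ring.
have Li3 : L * i ^+ 2 <= 2 * (L * (lc * i ^+ 3)) by rewrite [leRHS]mulrCA ler_wpM2l// (le_trans ler01 L1).
have L3 : 1 <= 4 * (L * i ^+ 2).
  have : i ^+ 2 <= L * i ^+ 2 by rewrite ler_peMl// exprn_ge0.
  lra.
have CL0 : 0 <= C * L by rewrite mulr_ge0 ?(le_trans ler01 L1)// CE exprn_ge0.
have -> : C * L ^+ 1 * (1 + lc * i ^+ 3) = C * L + C * (L * (lc * i ^+ 3)).
  by rewrite expr1; ring.
move: TS S0le CL0; rewrite -(mulrA (64 ^+ 2)); move: Li3 L3 (T * S) (C * L).
by rewrite CE; move: (L * i ^+ 2) (L * (lc * i ^+ 3)) => a b *; lra.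
Qed.

Lemma small_constants : [/\ (0 : R) <= 64 * 96 <= C, (0 : R) <= 8 * 128 ^+ 2 <= C,
  (0 : R) <= 64 ^+ 2 <= C & (0 : R) <= 3 * 32 ^+ 3 <= C].
Proof. by rewrite CE; split; apply/andP; split; lra. Qed.

End parameter_bounds.

(* The existentially quantified C and k are the absolute constant and the
   degree of the suppressed polylogarithmic factors; O(f) is read as O(1 + f)
   for a natural number parameter. *)
Theorem theorem4 (R : realType) :
  exists (C : R) (k : nat),
  forall (d : measure_display) (X : measurableType d)
    (B : {fset (X -> bool)}) (H : set (X -> bool))
    (D : probability (X * bool)%type R) (gamma eps delta : R),
  B != fset0 ->
  (forall b : X -> bool, b \in B -> measurable_fun [set: X] b) ->
  H !=set0 ->
  (forall h : X -> bool, H h -> measurable_fun [set: X] h) ->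
  0 < gamma <= 1 -> 0 < eps -> 0 < delta ->
  let L := polylog_base gamma eps delta (logcard B) in
  let Lm := polylog_base gamma eps delta (#|` B|)%:R in
  exists (eta : R) (eta_gt0 : 0 < eta) (sigma tau : R) (T S S0 r : nat),
  [/\ (0 < T)%N /\
      T%:R <= C * L ^+ k * (1 + logcard B / (gamma ^+ 2 * eps ^+ 2)),
      eta <= C * L ^+ k * (gamma ^+ 2 * eps / logcard B),
      sigma = eta / gamma /\ sigma <= 1,
      0 < tau <= C * L ^+ k * (gamma * eps)
    & (0 < S)%N /\ S%:R <= C * L ^+ k * (1 + (gamma * eps)^-1)] /\
  [/\ (0 < S0)%N /\ S0%:R <= C * L ^+ k * (1 + (eps ^+ 2)^-1),
      r%:R <= C * Lm ^+ k * (1 + (gamma ^+ 2 * eps ^+ 2)^-1),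
      (T * S + S0)%:R <=
        C * L ^+ k * (1 + logcard B / (gamma ^+ 3 * eps ^+ 3))
    & forall (W : learner R B) (mW : R -> R -> option nat),
      agnostic_weak_learner gamma H W mW ->
      forall (eps0 delta0 : R) (m0 : nat), 0 < eps0 -> 0 < delta0 ->
      mW eps0 delta0 = Some m0 ->
      ((1 - 10 * delta0 * T%:R - 10 * delta * T%:R)%:E <=
       Prob
         (boost D W gamma eta_gt0 sigma tau T S S0 (m0 + r)%N potential)
         [set run | well_posed eta sigma potential run.1 ->
            forall hbar : X -> bool, outputs eta run hbar ->
            (max_corr D H - 2 * eps0 / gamma - eps <= corr D hbar)%R])%E].
Proof.
exists (10 ^+ 9), 1%N => d X B H D gamma eps delta B0 mB H0 mH gamma01 eps_gt0 delta_gt0 L Lm.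
have /andP[gamma_gt0 gamma_le1] := gamma01.
set lc := logcard B; move CE : (10 ^+ 9 : R) => C.
have C1 : 1 <= C by rewrite -CE; lra.
have N1 : 1 <= (#|` B|)%:R :> R by rewrite ler1n cardfs_gt0.
have lc1 : 1 <= lc by rewrite /lc /logcard le_max lexx.
have lnN : ln (#|` B|)%:R <= lc by rewrite /lc /logcard le_max lexx orbT.
have lc_gt0 : 0 < lc by lra.
have L1 : 1 <= L by exact: polylog_ge1.
have Lm1 : 1 <= Lm by exact: polylog_ge1.
have C2 : 2 <= C by rewrite -CE; lra.
have L0 : 0 <= L by exact: le_trans L1.
have Lm0 : 0 <= Lm by exact: le_trans Lm1.
have C0 : 0 <= C by exact: le_trans C1.
have CL2 : 2 <= C * L ^+ 1 by rewrite expr1 -[2]mulr1 ler_pM.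
have CL1 : 1 <= C * L ^+ 1 by apply: le_trans CL2; rewrite ler1n.
have ge_gt0 : 0 < gamma * eps by exact: mulr_gt0.
pose i := (gamma * eps)^-1.
have i_gt0 : 0 < i by rewrite invr_gt0.
have i2E : (gamma ^+ 2 * eps ^+ 2)^-1 = i ^+ 2 by rewrite -exprMn exprVn.
have i3E : (gamma ^+ 3 * eps ^+ 3)^-1 = i ^+ 3 by rewrite -exprMn exprVn.
rewrite -/i i2E i3E.
have x1 : 0 <= lc * i ^+ 2 by rewrite mulr_ge0 ?exprn_ge0// ltW.
have x2 : 0 <= i ^+ 2 by rewrite exprn_ge0// ltW.
have x3 : 0 <= lc * i ^+ 3 by rewrite mulr_ge0 ?exprn_ge0// ltW.
have x4 : 0 <= (eps ^+ 2)^-1 by rewrite invr_ge0 exprn_ge0// ltW.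
have y_gt0 : 0 < gamma ^+ 2 * eps / lc by rewrite divr_gt0// mulr_gt0// exprn_gt0.
have [eps_le2|eps_gt2] := lerP eps 2; last first.
  (* For eps > 2 every output succeeds, since correlations lie in [-1, 1]. The minimum with [gamma]
     keeps [sigma] at most 1. *)
  pose eta := Num.min gamma (gamma ^+ 2 * eps / lc).
  have eta_gt0 : 0 < eta by rewrite lt_min gamma_gt0.
  have two_le (x : R) : 0 <= x -> 2 <= C * L ^+ 1 * (1 + x).
    by move=> x0; rewrite -[2]mulr1 ler_pM// lerDl.
  have one_le (x : R) : 0 <= x -> 1 <= C * L ^+ 1 * (1 + x).
    by move=> /two_le; apply: le_trans; rewrite ler1n.
  exists eta, eta_gt0, (eta / gamma), (gamma * eps), 1%N, 1%N, 1%N, 0%N.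
  split; split => //.
  - by split => //; exact: one_le.
  - apply: (@le_trans _ _ (gamma ^+ 2 * eps / lc)); first by rewrite ge_min lexx orbT.
    by rewrite ler_peMl// ltW.
  - by split => //; rewrite ler_pdivrMr// mul1r ge_min lexx.
  - by rewrite ge_gt0 ler_peMl// ltW.
  - by split => //; apply: one_le; rewrite ltW.
  - by split => //; apply: one_le.
  - by apply: mulr_ge0; [apply: mulr_ge0 => //; exact: exprn_ge0|exact: addr_ge0].
  - exact: two_le.
  - move=> W mW _ eps0 delta0 m0 eps0_gt0 delta0_gt0 _.
    rewrite /Prob (_ : (fun x => _) = (fun=> 1%E)); last first.
      apply/funext => run; rewrite indicE mem_set// => _ hbar _.
      have := max_corr_le1 D H0; have := normr_corr_le1 D hbar.
      rewrite ler_norml => /andP[h1 _] h2.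
      have : 0 <= 2 * eps0 / gamma by rewrite divr_ge0 ?mulr_ge0// ltW.
      lra.
    have mono : monotone_law (boost D W gamma eta_gt0 (eta / gamma) (gamma * eps) 1 1 1
        (m0 + 0) potential).
      apply: monotone_bind => [|hist]; first exact: monotone_rounds.
      apply: monotone_bind => [|D0]; last exact: monotone_ret.
      exact: (monotone_iid _ (monotone_draw D)).
    rewrite (law_cst1 mono) lee_fin !mulr1.
    by move: delta_gt0; lra.
have i2 : 2^-1 <= i.
  by rewrite lef_pV2 ?posrE// (le_trans _ eps_le2)// ler_piMl// ltW.
have e2 : (eps ^+ 2)^-1 <= i ^+ 2.
  rewrite -exprVn lerXn2r ?nnegrE ?invr_ge0 ?(ltW eps_gt0) ?(ltW ge_gt0)//.
  by rewrite lef_pV2 ?posrE// ler_piMl// ltW.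
have N0 : 0 < (#|` B|)%:R :> R by exact: lt_le_trans N1.
have ln_delta : - ln delta <= L by exact: lnV_le_polylog.
have ln_delta' : - ln delta <= Lm by exact: lnV_le_polylog.
have lnN' : ln (#|` B|)%:R <= Lm by exact: ln_le_polylog.
have ln2 := @ln2_le1 R.
pose eta := gamma ^+ 2 * eps / (64 * lc).
have eta_gt0 : 0 < eta by rewrite divr_gt0 ?mulr_gt0 ?exprn_gt0.
pose sigma := eta / gamma.
have sigmaE : sigma = gamma * eps / (64 * lc).
  by rewrite /sigma /eta; field; rewrite !gt_eqF.
have sigma_gt0 : 0 < sigma by rewrite divr_gt0.
have sigma_le1 : sigma <= 1.
  rewrite sigmaE ler_pdivrMr ?mulr_gt0// mul1r.
  have : gamma * eps <= 2 by rewrite (le_trans _ eps_le2)// ler_piMl// ltW.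
  lra.
have eta_small : eta <= gamma ^+ 2 * eps / 64.
  rewrite /eta invfM mulrA ler_piMr ?invf_le1//.
  by rewrite divr_ge0// mulr_ge0 ?exprn_ge0// ltW.
(* The constants are tuned to the conditions of [boost_guarantee]: 64 * 96 makes eta eps T exceed
   96, and those of [S], [S'] and [r] produce the exponents 4 L lc, 2 L and 3 Lm. *)
have [T [T0 T1 T2]] : exists n : nat, [/\ (0 < n)%N, 64 * 96 * (lc * i ^+ 2) < n%:R &
    n%:R <= 64 * 96 * (lc * i ^+ 2) + 1].
  by apply: nat_upper_approx; rewrite mulr_ge0// mulr_ge0.
have [S [S0 S1 S2]] : exists n : nat, [/\ (0 < n)%N, 8 * 128 ^+ 2 * L * i < n%:R &
    n%:R <= 8 * 128 ^+ 2 * L * i + 1].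
  by apply: nat_upper_approx; rewrite mulr_ge0 ?(ltW i_gt0)// mulr_ge0// mulr_ge0// exprn_ge0.
have [S' [S'0 S'1 S'2]] : exists n : nat, [/\ (0 < n)%N, 64 ^+ 2 * L * (eps ^+ 2)^-1 < n%:R &
    n%:R <= 64 ^+ 2 * L * (eps ^+ 2)^-1 + 1].
  by apply: nat_upper_approx; rewrite mulr_ge0// mulr_ge0// mulr_ge0// exprn_ge0.
have [r [r0 r1 r2]] : exists n : nat, [/\ (0 < n)%N, 3 * 32 ^+ 3 * Lm * i ^+ 2 < n%:R &
    n%:R <= 3 * 32 ^+ 3 * Lm * i ^+ 2 + 1].
  by apply: nat_upper_approx; rewrite mulr_ge0// mulr_ge0// mulr_ge0// exprn_ge0.
have [c1 c2 c3 c4] := small_constants (esym CE).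
exists eta, eta_gt0, sigma, (gamma * eps / 8), T, S, S', r.
split; split => //.
- split => //; apply: (@polylog_bound _ L C L1 (esym CE) (64 * 96)) => //.
  by apply: le_trans T2 _; rewrite lerD2r ler_wpM2r// ler_peMr.
- rewrite (_ : eta = gamma ^+ 2 * eps / lc / 64); last by rewrite /eta; field; rewrite gt_eqF.
  apply: (@le_trans _ _ (gamma ^+ 2 * eps / lc)); last by rewrite ler_peMl// ltW.
  by rewrite ler_pdivrMr// ler_peMr ?(ltW y_gt0)// ler1n.
- rewrite divr_gt0//=; apply: (@le_trans _ _ (gamma * eps)); last by rewrite ler_peMl// ltW.
  by rewrite ler_pdivrMr// ler_peMr ?(ltW ge_gt0)// ler1n.
- split => //; apply: (@polylog_bound _ L C L1 (esym CE) (8 * 128 ^+ 2)) => //.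
  exact: ltW.
- split => //; apply: (@polylog_bound _ L C L1 (esym CE) (64 ^+ 2)) => //.
- apply: (@polylog_bound _ Lm C Lm1 (esym CE) (3 * 32 ^+ 3)) => //.
- rewrite natrD natrM; apply: (@sample_bound _ L lc i C L1 lc1 i2 (esym CE)) => //.
  by apply: le_trans S'2 _; rewrite lerD2r ler_wpM2l// mulr_ge0// exprn_ge0.
apply: boost_guarantee => //.
- by rewrite eps_gt0.
- have -> : 96 = eta * eps * (64 * 96 * (lc * i ^+ 2)).
    by rewrite /eta /i; field; rewrite !gt_eqF.
  by rewrite ltr_pM2l// mulr_gt0.
- have N1_gt0 : 0 < 1 + (#|` B|)%:R :> R by rewrite addr_gt0.
  apply: (mulr_expRN_le (mulr_gt0 (ltr0n _ 2) N1_gt0) delta_gt0).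
  rewrite lnM ?posrE ?addr_gt0//.
  have h1 : ln (1 + (#|` B|)%:R) <= ln 2 + ln (#|` B|)%:R :> R.
    rewrite -lnM ?posrE// ler_ln ?posrE ?addr_gt0 ?mulr_gt0//; lra.
  (* The union bound costs log |B|, yet [S] contains only [L]: the missing factor [lc] comes from 1
     / sigma in the exponent. *)
  apply: (@le_trans _ _ (4 * (L * lc))).
    have : lc <= L * lc by rewrite ler_peMl// ltW.
    have : L <= L * lc by rewrite ler_peMr.
    by move: (L * lc) => *; lra.
  have -> : 4 * (L * lc) = (gamma * eps / 128) ^+ 2 * (8 * 128 ^+ 2 * L * i) / (128 * sigma).
    by rewrite sigmaE /i; field; rewrite !gt_eqF.
  apply: ler_wpM2r; first by rewrite invr_ge0 mulr_ge0// ltW.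
  by rewrite ler_wpM2l ?sqr_ge0// ltW.
(* The [r] extra samples have no small variance factor to exploit, so the log |B| of the union bound
   is paid by [Lm], whose argument contains |B| itself. *)
- apply: (mulr_expRN_le (mulr_gt0 (ltr0n _ 2) N0) delta_gt0).
  rewrite lnM ?posrE//; apply: (@le_trans _ _ (3 * Lm)); first by move: ln_delta' lnN' Lm1 ln2; lra.
  have -> : 3 * Lm = (3 * 32 ^+ 3 * Lm * i ^+ 2) * (gamma * eps / 32) ^+ 2 / 32.
    by rewrite /i; field; rewrite !gt_eqF.
  by rewrite ler_wpM2r ?invr_ge0// ler_wpM2r ?sqr_ge0// ltW.
- apply: (mulr_expRN_le (ltr0n _ 2) delta_gt0); apply: (@le_trans _ _ (2 * L)); first by lra.
  have -> : 2 * L = (64 ^+ 2 * L * (eps ^+ 2)^-1) * (eps / 8) ^+ 2 / 32.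
    by field; rewrite gt_eqF.
  by rewrite ler_wpM2r ?invr_ge0// ler_wpM2r ?sqr_ge0// ltW.
Qed.
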